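(* Let $\Gamma\vdash A$ be a type in the cubical assembly model. Suppose that $A$, as an internal presheaf on the category of elements $\mathrm{El}(\Gamma)$, is uniform and well-supported and does not have a section. Then the function $\Gamma\vdash\eta_A:A\to A^{*}$ is not an equivalence.
   Context: Assemblies: a set $A$ with non-empty realizer sets $E_A(a)\subseteq\mathbb N$; morphisms are functions tracked by partial recursive functions. $\mathrm{Asm}$ is a model of extensional dependent type theory (types over $\Gamma$: families of assemblies over the underlying set; terms: uniformly tracked sections) with $\Pi,\Sigma$, identity types, unit, disjoint finite coproducts, natural numbers, propositional truncation. $\mathrm{PER}$: the assembly of partial equivalence relations on $\mathbb N$ with $\mathrm{el}(R)=\mathbb N/R$; an impredicative universe classifying modest families. Internal category $\mathbb B_{ord}$ in $\mathrm{Asm}$: objects $\mathbb N$, morphisms $m\to n$ the order-preserving maps $(\mathrm{Fin}_m\to\mathbf2)\to(\mathrm{Fin}_n\to\mathbf2)$ ($\mathrm{Fin}_n=\{k<n\}$); it has finite products and path connection algebra $\mathbb I=1$ (end-points the constants $0,1$, connections $\min,\max$). Cubical assembly model: $\mathcal E=\mathrm{PSh}(\mathbb B_{ord})$ (internal presheaf model: contexts are presheaves, types over $\Gamma$ are presheaves on $\mathrm{El}(\Gamma)$, terms are sections) with interval $\mathbf y\mathbb I$, $\mathrm{Cof}=[\mathbb B_{ord}^{op},\mathbf2]$ and $\mathcal U=[\mathbb B_{ord}^{op},\mathrm{PER}]$ (Hofmann–Streicher lifts: $[\mathbb C^{op},U](c)$ is the type of functors $(\mathbb C/c)^{op}\to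 U$, $\mathrm{el}(c,A)=\mathrm{el}_U(A(\mathrm{id}_c))$). Internally: $\mathrm{Comp}^i(A(i)):=\prod_{e:\mathbf2}\prod_{\varphi:\mathrm{Cof}}\prod_{f:\varphi\to\prod_iA(i)}\prod_{a:A(e)}(\forall_{u:\varphi}fue=a)\to\{a':A(\bar e)\mid\forall_{u:\varphi}fu\bar e=a'\}$ ($\bar0=1,\bar1=0$, $\mathbf2\subseteq\mathbb I$ via end-points), $\mathrm{Fib}(A):=\prod_{p:\mathbb I\to\Gamma}\mathrm{Comp}^i(A(pi))$; types of the cubical assembly model are fibrations (types with a global element of $\mathrm{Fib}$). $\mathcal U^F$ classifies fibrations with underlying type in $\mathcal U$. $\mathrm{Path}(A,a_0,a_1):=\{p:\mathbb I\to A\mid p0=a_0\wedge p1=a_1\}$; $\mathrm{hProp}:=\sum_{X:\mathcal U^F}\prod_{x_0,x_1:X}\mathrm{Path}(X,x_0,x_1)$; $A^{*}:=\prod_{X:\mathrm{hProp}}(A\to X)\to X$; $\eta_A:=\lambda a.\lambda Xf.fa$. A map $f:A\to B$ of fibrations is an equivalence if each fiber $\sum_{a:A}\mathrm{Path}(B,b,fa)$ is contractible. An assembly is uniform if all its elements share a realizer; an internal presheaf is uniform if each component is; it is well-supported if its map to the terminal presheaf is regular epi (equivalently a partial recursive function computes, from a realizer of an object $c$, a realizer of some element of $A(c)$). *)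

(* Defs.v *)
From mathcomp Require Import all_boot.
From mathcomp Require Import boolp.
From Stdlib Require Cantor.

Set Implicit Arguments.
Unset Strict Implicit.
Unset Printing Implicit Defensive.

Definition pr (a b : nat) : nat := Cantor.to_nat (a, b).
Definition un1 (n : nat) : nat := (Cantor.of_nat n).1.
Definition un2 (n : nat) : nat := (Cantor.of_nat n).2.

Lemma un1_pr a b : un1 (pr a b) = a.
Proof. by rewrite /un1 /pr Cantor.cancel_of_to. Qed.
Lemma un2_pr a b : un2 (pr a b) = b.
Proof. by rewrite /un2 /pr Cantor.cancel_of_to. Qed.
Lemma pr_un n : pr (un1 n) (un2 n) = n.
Proof. by rewrite /un1 /un2 /pr -surjective_pairing Cantor.cancel_to_of. Qed.

Lemma pr_inj a b c d : pr a b = pr c d -> a = c /\ b = d.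
Proof.
by move=> e; split; [rewrite -(un1_pr a b) e un1_pr | rewrite -(un2_pr a b) e un2_pr].
Qed.

Opaque pr.

Notation "<< x , .. , y , z >>" := (pr x .. (pr y z) ..)
  (at level 0, format "<< x ,  .. ,  y ,  z >>").

(* Goedel numbers of unary partial recursive functions; n-ary functions are
   unary ones on iterated pairs. *)
Definition c_cst k := << 0, k >>.
Definition c_suc := << 1, 0 >>.
Definition c_id := << 2, 0 >>.
Definition c_fst := << 3, 0 >>.
Definition c_snd := << 4, 0 >>.
Definition c_pair e1 e2 := << 5, e1, e2 >>.
Definition c_comp e1 e2 := << 6, e1, e2 >>.
Definition c_prec e0 e1 := << 7, e0, e1 >>.
Definition c_mu e := << 8, e >>.

(* [kapp e n m]: the partial recursive function with Goedel number e is defined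
   at n with value m. *)
Inductive kapp : nat -> nat -> nat -> Prop :=
| kapp_cst k n : kapp (c_cst k) n k
| kapp_suc n : kapp c_suc n n.+1
| kapp_id n : kapp c_id n n
| kapp_fst a b : kapp c_fst << a, b >> a
| kapp_snd a b : kapp c_snd << a, b >> b
| kapp_pair e1 e2 n a b :
    kapp e1 n a -> kapp e2 n b -> kapp (c_pair e1 e2) n << a, b >>
| kapp_comp e1 e2 n k m :
    kapp e2 n k -> kapp e1 k m -> kapp (c_comp e1 e2) n m
| kapp_prec0 e0 e1 x m :
    kapp e0 x m -> kapp (c_prec e0 e1) << x, 0 >> m
| kapp_precS e0 e1 x n k m :
    kapp (c_prec e0 e1) << x, n >> k -> kapp e1 << x, n, k >> m ->
    kapp (c_prec e0 e1) << x, n.+1 >> m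
| kapp_mu e x n (v : nat -> nat) :
    (forall k, k < n -> kapp e << x, k >> (v k).+1) ->
    kapp e << x, n >> 0 -> kapp (c_mu e) x n.

Lemma kapp_fst' n : kapp c_fst n (un1 n).
Proof. by rewrite -{1}(pr_un n); constructor. Qed.
Lemma kapp_snd' n : kapp c_snd n (un2 n).
Proof. by rewrite -{1}(pr_un n); constructor. Qed.

(** A universal index [c_ev], obtained by simulating an abstract machine whose
    states are pairs of a stack of frames and a value *)

Definition total (F : nat -> nat) := exists e, forall n, kapp e n (F n).

Lemma total_eq F G : F =1 G -> total F -> total G.
Proof. by move=> FG [e He]; exists e => n; rewrite -FG. Qed.
Lemma total_id : total (fun n => n).
Proof. by exists c_id => n; constructor. Qed.
Lemma total_cst k : total (fun=> k).
Proof. by exists (c_cst k) => n; constructor. Qed.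
Lemma total_fst F : total F -> total (fun n => un1 (F n)).
Proof. by case=> e He; exists (c_comp c_fst e) => n; econstructor; [exact: He|exact: kapp_fst']. Qed.
Lemma total_snd F : total F -> total (fun n => un2 (F n)).
Proof. by case=> e He; exists (c_comp c_snd e) => n; econstructor; [exact: He|exact: kapp_snd']. Qed.
Lemma total_suc F : total F -> total (fun n => (F n).+1).
Proof. by case=> e He; exists (c_comp c_suc e) => n; econstructor; [exact: He|constructor]. Qed.
Lemma total_pair F G : total F -> total G -> total (fun n => << F n, G n >>).
Proof. by case=> e He [f Hf]; exists (c_pair e f) => n; constructor. Qed.
Lemma total_comp F G : total F -> total G -> total (fun n => F (G n)).
Proof. by case=> e He [f Hf]; exists (c_comp e f) => n; econstructor; [exact: Hf|exact: He]. Qed.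
Lemma total_prec F G : total F -> total G ->
  total (fun n => nat_rect (fun=> nat) (F (un1 n))
                    (fun k r => G << un1 n, k, r >>) (un2 n)).
Proof.
case=> e He [f Hf]; exists (c_prec e f) => n.
rewrite -{1}(pr_un n); elim: (un2 n) => [|k IH] /=; first by constructor.
by econstructor; [exact: IH|exact: Hf].
Qed.
Lemma total_pred F : total F -> total (fun n => (F n).-1).
Proof.
move=> tF; apply: (@total_eq (fun n => (fun m => nat_rect (fun=> nat) 0
  (fun k r => un1 (un2 << un1 m, k, r >>)) (un2 m)) << 0, F n >>)).
  by move=> n /=; rewrite un2_pr; case: (F n) => //= k; rewrite un2_pr un1_pr.
apply: (total_comp (F := fun m => nat_rect (fun=> nat) 0
  (fun k r => un1 (un2 << un1 m, k, r >>)) (un2 m))).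
  apply: (total_prec (F := fun=> 0) (G := fun x => un1 (un2 x))).
    exact: total_cst.
  exact/total_fst/total_snd/total_id.
exact: total_pair (total_cst _) tF.
Qed.
Definition ifz (t a b : nat) := if t is 0 then a else b.
Lemma total_ifz T F G : total T -> total F -> total G ->
  total (fun n => ifz (T n) (F n) (G n)).
Proof.
move=> tT tF tG; apply: (@total_eq (fun n => (fun m => nat_rect (fun=> nat) (F (un1 m))
  (fun k r => G (un1 << un1 m, k, r >>)) (un2 m)) << n, T n >>)).
  by move=> n /=; rewrite un2_pr un1_pr; case: (T n) => //= k; rewrite un1_pr.
apply: (total_comp (F := fun m => nat_rect (fun=> nat) (F (un1 m))
  (fun k r => G (un1 << un1 m, k, r >>)) (un2 m))).
  apply: (total_prec (G := fun x => G (un1 x))) => //.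
  by apply: total_comp tG _; exact/total_fst/total_id.
exact: total_pair total_id tT.
Qed.

Definition push fr K := << fr, K >>.+1.
Definition k_pair1 e v := << 9, e, v >>.
Definition k_pair2 a := << 10, a >>.
Definition k_prec e x n := << 11, e, x, n >>.
Definition k_mu e x n := << 12, e, x, n >>.

Definition step_body (K v fr d t : nat) : nat :=
  ifz t << K, d >>
 (ifz t.-1 << K, v.+1 >>
 (ifz t.-2 << K, v >>
 (ifz t.-2.-1 << K, un1 v >>
 (ifz t.-2.-2 << K, un2 v >>
 (ifz t.-2.-2.-1 << push (un1 d) (push (k_pair1 (un2 d) v) K), v >>
 (ifz t.-2.-2.-2 << push (un2 d) (push (un1 d) K), v >>
 (ifz t.-2.-2.-2.-1
    (ifz (un2 v) << push (un1 d) K, un1 v >>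
       << push fr (push (k_prec (un2 d) (un1 v) (un2 v).-1) K), un1 v, (un2 v).-1 >>)
 (ifz t.-2.-2.-2.-2 << push d (push (k_mu d v 0) K), v, 0 >>
 (ifz t.-2.-2.-2.-2.-1 << push (un1 d) (push (k_pair2 v) K), un2 d >>
 (ifz t.-2.-2.-2.-2.-2 << K, d, v >>
 (ifz t.-2.-2.-2.-2.-2.-1
    << push (un1 d) K, un1 (un2 d), un2 (un2 d), v >>
    (ifz v << K, un2 (un2 d) >>
       << push (un1 d) (push (k_mu (un1 d) (un1 (un2 d)) (un2 (un2 d)).+1) K),
          un1 (un2 d), (un2 (un2 d)).+1 >>)))))))))))).

Definition step (s : nat) : nat :=
  let fr := un1 (un1 s).-1 in
  ifz (un1 s) s (step_body (un2 (un1 s).-1) (un2 s) fr (un2 fr) (un1 fr)).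

Ltac total_tac := repeat first
  [ exact: total_id | exact: total_cst
  | apply: total_ifz | apply: total_pair | apply: total_suc
  | apply: total_pred | apply: total_fst | apply: total_snd ].

Lemma total_step : total step.
Proof. by rewrite /step /step_body /push /k_pair1 /k_prec /k_mu; total_tac. Qed.

Lemma stepE fr K v :
  step << push fr K, v >> = step_body K v fr (un2 fr) (un1 fr).
Proof. by rewrite /step /push un1_pr un2_pr /= un1_pr un2_pr. Qed.

Definition reach s s' := exists j, iter j step s = s'.
Lemma reach0 s : reach s s. Proof. by exists 0. Qed.
Lemma reachS s s' : reach (step s) s' -> reach s s'.
Proof. by case=> j <-; exists j.+1; rewrite iterSr. Qed.
Lemma reachT s s' s'' : reach s s' -> reach s' s'' -> reach s s''.
Proof. by case=> j <- [k <-]; exists (k + j); rewrite iterD. Qed.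

Ltac mstep := apply: reachS; rewrite stepE /step_body
  ?/c_cst ?/c_suc ?/c_id ?/c_fst ?/c_snd ?/c_pair ?/c_comp ?/c_prec ?/c_mu
  ?/k_pair1 ?/k_pair2 ?/k_prec ?/k_mu !(un1_pr, un2_pr) /= ?(un1_pr, un2_pr) /=.

Lemma kapp_reach e n m : kapp e n m -> forall K, reach << push e K, n >> << K, m >>.
Proof.
elim=> {e n m}.
- by move=> k n K; mstep; exact: reach0.
- by move=> n K; mstep; exact: reach0.
- by move=> n K; mstep; exact: reach0.
- by move=> a b K; mstep; exact: reach0.
- by move=> a b K; mstep; exact: reach0.
- move=> e1 e2 n a b _ IH1 _ IH2 K; mstep.
  apply: reachT (IH1 _) _; mstep; apply: reachT (IH2 _) _; mstep; exact: reach0.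
- move=> e1 e2 n k m _ IH1 _ IH2 K; mstep.
  apply: reachT (IH1 _) _; exact: IH2.
- by move=> e0 e1 x m _ IH K; mstep; exact: IH.
- move=> e0 e1 x n k m _ IH1 _ IH2 K; mstep.
  apply: reachT (IH1 _) _; mstep; exact: IH2.
- move=> e x n v _ IH1 _ IH2 K; mstep.
  suff H j : forall k, n - k = j -> k <= n ->
      reach << push e (push (k_mu e x k) K), x, k >> << K, n >> by apply: (H n) => //; rewrite subn0.
  elim: j => [|j IH] k.
    move/eqP; rewrite subn_eq0 => nk kn.
    have -> : k = n by apply/eqP; rewrite eqn_leq kn.
    by apply: reachT (IH2 _) _; mstep; exact: reach0.
  move=> ej kn; have kn' : k < n by rewrite -subn_gt0 ej.
  apply: reachT (IH1 _ kn' _) _; mstep.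
  by apply: (IH k.+1); rewrite // subnS ej.
Qed.

Lemma universal : exists u, forall e n m, kapp e n m -> kapp u << e, n >> m.
Proof.
pose run q := nat_rect (fun=> nat) (un1 q) (fun k r => step (un2 (un2 << un1 q, k, r >>))) (un2 q).
have runE s j : run << s, j >> = iter j step s.
  rewrite /run un1_pr un2_pr.
  by elim: j => //= j ->; rewrite !un2_pr.
have t_run : total run.
  apply: (total_prec (F := fun n => n) (G := fun x => step (un2 (un2 x)))).
    exact: total_id.
  by apply: (total_comp total_step); total_tac.
have [r Hr] := t_run.
have [h Hh] : total (fun q => un1 (run q)) by apply: total_fst.
have [i Hi] : total (fun q => << push (un1 q) 0, un2 q >>) by rewrite /push; total_tac.
exists (c_comp (c_comp c_snd (c_comp r (c_pair c_id (c_mu h)))) i) => e n m H.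
have [j ej] := kapp_reach H 0.
set s := << push e 0, n >> in ej.
have stop : exists k, un1 (iter k step s) == 0 by exists j; rewrite ej un1_pr.
have jP : un1 (iter j step s) == 0 by rewrite ej un1_pr.
case: (ex_minnP stop) => k /eqP k0 kmin.
have fixd d : iter (d + k) step s = iter k step s.
  by elim: d => // d IH; rewrite addSn iterS IH {1}/step k0.
have ek : iter k step s = << 0, m >> by rewrite -ej -(subnK (kmin _ jP)) fixd.
apply: kapp_comp; first by have := Hi << e, n >>; rewrite un1_pr un2_pr; exact.
apply: kapp_comp; last exact: (kapp_snd 0).
apply: kapp_comp; last by rewrite -ek -runE; exact: Hr.
rewrite un1_pr un2_pr -/s; apply: kapp_pair; first exact: kapp_id.
apply: (@kapp_mu _ _ _ (fun l => (un1 (iter l step s)).-1)) => [l lk|].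
  rewrite prednK; first by have := Hh << s, l >>; rewrite runE.
  rewrite lt0n; apply/negP => l0.
  by have := kmin _ l0; rewrite leqNgt lk.
by have := Hh << s, k >>; rewrite runE ek un1_pr.
Qed.

(** Expressions for building indices; [Arg] is the input and, under [Lam], the
    pair of the outer input and the bound value *)

Inductive expr :=
  | Arg | Cst of nat | Fst of expr | Snd of expr | Pair of expr & expr | App of expr & expr | Lam of expr.

Definition c_ev : nat := sval (cid universal).
Lemma c_evP e n m : kapp e n m -> kapp c_ev << e, n >> m.
Proof. exact: (svalP (cid universal)). Qed.

Fixpoint code (t : expr) : nat :=
  match t with
  | Arg => c_id
  | Cst k => c_cst k
  | Fst t => c_comp c_fst (code t)
  | Snd t => c_comp c_snd (code t)
  | Pair t u => c_pair (code t) (code u)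
  | App t u => c_comp c_ev (c_pair (code t) (code u))
  | Lam t => c_pair (c_cst 6) (c_pair (c_cst (code t))
               (c_pair (c_cst 5) (c_pair (c_pair (c_cst 0) c_id) (c_cst c_id))))
  end.
Definition clo (t : expr) (r : nat) := c_comp (code t) (c_pair (c_cst r) c_id).
Inductive den : expr -> nat -> nat -> Prop :=
| den_arg r : den Arg r r
| den_cst k r : den (Cst k) r k
| den_fst t r a b : den t r << a, b >> -> den (Fst t) r a
| den_snd t r a b : den t r << a, b >> -> den (Snd t) r b
| den_pair t u r a b : den t r a -> den u r b -> den (Pair t u) r << a, b >>
| den_app t u r a b c : den t r a -> den u r b -> kapp a b c -> den (App t u) r c
| den_lam t r : den (Lam t) r (clo t r).
Lemma den_code t r a : den t r a -> kapp (code t) r a.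
Proof.
elim=> {t r a} /=; try by [move=> *; constructor].
- by move=> t r a b _ H; econstructor; [exact: H|constructor].
- by move=> t r a b _ H; econstructor; [exact: H|constructor].
- move=> t u r a b c _ H1 _ H2 H; econstructor; first by constructor; eassumption.
  exact: c_evP.
- by move=> t r; repeat constructor.
Qed.
Lemma den_clo t r x a : den t << r, x >> a -> kapp (clo t r) x a.
Proof. by move/den_code=> H; econstructor; [repeat constructor|exact: H]. Qed.

Arguments code : simpl never.

Notation Pj0 t := (Fst t).
Notation Pj1 t := (Fst (Snd t)).
Notation Pj2 t := (Fst (Snd (Snd t))).
Notation Pj3 t := (Fst (Snd (Snd (Snd t)))).
Notation Pj4 t := (Fst (Snd (Snd (Snd (Snd t))))).
Notation Tl2 t := (Snd (Snd t)).
Notation Tl3 t := (Snd (Snd (Snd t))).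
Notation Tl4 t := (Snd (Snd (Snd (Snd t)))).
Notation Tl5 t := (Snd (Snd (Snd (Snd (Snd t))))).

Ltac run := lazymatch goal with
  | |- kapp (code _) _ _ => apply: den_code; run
  | |- kapp (clo _ _) _ _ => apply: den_clo; run
  | |- kapp _ _ _ => eassumption
  | |- den Arg _ _ => apply: den_arg
  | |- den (Cst _) _ _ => apply: den_cst
  | |- den (Fst _) _ _ => eapply den_fst; run
  | |- den (Snd _) _ _ => eapply den_snd; run
  | |- den (Pair _ _) _ _ => eapply den_pair; run
  | |- den (App _ _) _ _ => eapply den_app; [run | run | run]
  | |- den (Lam _) _ _ => apply: den_lam
  | |- den ?t ?r ?v => let t' := eval hnf in t in change (den t' r v); run
  end.

Record asm := Asm {
  car :> Type;
  rz : nat -> car -> Prop;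
  rz_ex : forall x : car, exists n, rz n x }.
Arguments rz {a}.
Notation "n ||- x" := (rz n x) (at level 70, no associativity).

(* e.n is defined and realizes x *)
Definition yields (X : asm) (e n : nat) (x : X) := exists m, kapp e n m /\ m ||- x.

Lemma yieldsI (X : asm) e n m (x : X) : kapp e n m -> m ||- x -> yields e n x.
Proof. by exists m. Qed.

Definition natA : asm := @Asm nat (fun n m => n = m) (fun m => ex_intro _ m erefl).
Definition boolA : asm :=
  @Asm bool (fun n b => n = nat_of_bool b) (fun b => ex_intro _ (nat_of_bool b) erefl).
Definition ordA (k : nat) : asm :=
  @Asm 'I_k (fun n i => n = nat_of_ord i) (fun i => ex_intro _ (nat_of_ord i) erefl).
Definition propA (P : Prop) : asm := @Asm P (fun _ _ => True) (fun _ => ex_intro _ 0 I).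

Definition subA (X : asm) (P : X -> Prop) : asm :=
  @Asm {x : X | P x} (fun n x => n ||- sval x) (fun x => rz_ex (sval x)).

Definition tracks (X Y : asm) (e : nat) (f : X -> Y) :=
  forall x n, n ||- x -> yields e n (f x).
Definition expA (X Y : asm) : asm :=
  @Asm {f : X -> Y | exists e, tracks e f} (fun e f => tracks e (sval f)) (fun f => svalP f).

Definition sig_rz (X : asm) (Y : X -> asm) (n : nat) (z : {x : X & Y x}) :=
  exists a b, [/\ n = << a, b >>, a ||- projT1 z & b ||- projT2 z].
Lemma sig_rz_ex (X : asm) (Y : X -> asm) z : exists n, @sig_rz X Y n z.
Proof.
case: z => x y; have [a Ha] := rz_ex x; have [b Hb] := rz_ex y.
by exists << a, b >>, a, b.
Qed.
Definition sigA (X : asm) (Y : X -> asm) : asm := Asm (@sig_rz_ex X Y).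

Lemma sval_inj T (P : T -> Prop) (x y : {x | P x}) : sval x = sval y -> x = y.
Proof. by case: x y => x px [y py] /= e; case: _ / e py => py; congr exist. Qed.

Notation "( x ; a )" := (existT _ x a) (at level 0, format "( x ;  a )").

Record icat := ICat {
  ob : asm;
  hom : ob -> ob -> asm;
  idm : forall x, hom x x;
  cmp : forall x y z, hom y z -> hom x y -> hom x z;
  cmp1m : forall x y (f : hom x y), cmp (idm y) f = f;
  cmpm1 : forall x y (f : hom x y), cmp f (idm x) = f;
  cmpA : forall x y z w (h : hom z w) (g : hom y z) (f : hom x y),
    cmp h (cmp g f) = cmp (cmp h g) f;
  idm_tr : exists e, forall x n, n ||- x -> yields e n (idm x);
  cmp_tr : exists e, forall x y z (g : hom y z) (f : hom x y) nx ny nz ng nf,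
    nx ||- x -> ny ||- y -> nz ||- z -> ng ||- g -> nf ||- f ->
    yields e << nx, ny, nz, ng, nf >> (cmp g f) }.
Arguments hom {i}.
Arguments idm {i}.
Arguments cmp {i x y z}.

Record psh (D : icat) := Psh {
  at_ :> ob D -> asm;
  res : forall x y, hom x y -> at_ y -> at_ x;
  res1 : forall x (a : at_ x), res (idm x) a = a;
  resM : forall x y z (g : hom y z) (f : hom x y) (a : at_ z),
    res (cmp g f) a = res f (res g a);
  res_tr : exists e, forall x y (f : hom x y) (a : at_ y) nx ny nf na,
    nx ||- x -> ny ||- y -> nf ||- f -> na ||- a ->
    yields e << nx, ny, nf, na >> (res f a) }.
Arguments res {D} p {x y}.

Record ifun (D E : icat) := IFun {
  fob :> ob D -> ob E;
  fhom : forall x y, hom x y -> hom (fob x) (fob y);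
  fhom1 : forall x, fhom (idm x) = idm (fob x);
  fhomM : forall x y z (g : hom y z) (f : hom x y), fhom (cmp g f) = cmp (fhom g) (fhom f);
  fob_tr : exists e, forall x n, n ||- x -> yields e n (fob x);
  fhom_tr : exists e, forall x y (f : hom x y) nx ny nf,
    nx ||- x -> ny ||- y -> nf ||- f -> yields e << nx, ny, nf >> (fhom f) }.
Arguments fhom {D E} i {x y}.

Record nt (D : icat) (A B : psh D) := NT {
  ntf :> forall x, A x -> B x;
  nt_nat : forall x y (f : hom x y) (a : A y), ntf (res A f a) = res B f (ntf a);
  nt_tr : exists e, forall x (a : A x) nx na,
    nx ||- x -> na ||- a -> yields e << nx, na >> (ntf a) }.

Definition tm_ax (D : icat) (A : psh D) (s : forall x, A x) :=
  (forall x y (f : hom x y), s x = res A f (s y)) /\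
  (exists e, forall x n, n ||- x -> yields e n (s x)).
Definition tm (D : icat) (A : psh D) : Type := {s : forall x, A x | tm_ax s}.

Lemma nt_eq (D : icat) (A B : psh D) (s t : nt A B) : (forall x a, s x a = t x a) -> s = t.
Proof.
case: s t => s s1 s2 [t t1 t2] /= st.
have e : s = t by apply: functional_extensionality_dep => x; apply: funext => a.
by case: _ / e t1 t2 {st} => t1 t2; congr NT; exact: Prop_irrelevance.
Qed.

Lemma nt_id_tr (D : icat) (A : psh D) : exists e, forall x (a : A x) nx na,
    nx ||- x -> na ||- a -> yields e << nx, na >> a.
Proof. by exists (code (Snd Arg)) => x a nx na _ Ha; apply: yieldsI Ha; run. Qed.
Definition nt_id (D : icat) (A : psh D) : nt A A :=
  @NT D A A (fun _ a => a) (fun _ _ _ _ => erefl) (nt_id_tr A).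

Section NtComp.
Variables (D : icat) (A B E : psh D) (t : nt B E) (s : nt A B).
Lemma nt_cmp_nat x y (f : hom x y) (a : A y) :
  t x (s x (res A f a)) = res E f (t y (s y a)).
Proof. by rewrite !nt_nat. Qed.
Lemma nt_cmp_tr : exists e, forall x (a : A x) nx na,
    nx ||- x -> na ||- a -> yields e << nx, na >> (t x (s x a)).
Proof.
have [et Ht] := nt_tr t; have [es Hs] := nt_tr s.
exists (code (App (Cst et) (Pair (Fst Arg) (App (Cst es) Arg)))) => x a nx na Hx Ha.
have [m1 [k1 r1]] := Hs _ _ _ _ Hx Ha.
have [m2 [k2 r2]] := Ht _ _ _ _ Hx r1.
by apply: yieldsI r2; run.
Qed.
Definition nt_cmp : nt A E := NT nt_cmp_nat nt_cmp_tr.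
End NtComp.

Section El.
Variables (D : icat) (A : psh D).
Definition el_ob : asm := sigA (fun x : ob D => A x).
(* A morphism (x,a) -> (y,b) is a morphism f : x -> y with b|f = a. *)
Definition el_hom (p q : el_ob) : asm :=
  subA (fun f : hom (projT1 p) (projT1 q) => res A f (projT2 q) = projT2 p).
Definition el_id (p : el_ob) : el_hom p p := exist _ (idm _) (res1 _).
Lemma el_cmp_ax (p q r : el_ob) (g : el_hom q r) (f : el_hom p q) :
  res A (cmp (sval g) (sval f)) (projT2 r) = projT2 p.
Proof. by rewrite resM (svalP g) (svalP f). Qed.
Definition el_cmp (p q r : el_ob) (g : el_hom q r) (f : el_hom p q) : el_hom p r :=
  exist _ (cmp (sval g) (sval f)) (el_cmp_ax g f).
Lemma el_cmp1m p q (f : el_hom p q) : el_cmp (el_id q) f = f.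
Proof. by apply: sval_inj; exact: cmp1m. Qed.
Lemma el_cmpm1 p q (f : el_hom p q) : el_cmp f (el_id p) = f.
Proof. by apply: sval_inj; exact: cmpm1. Qed.
Lemma el_cmpA p q r s (h : el_hom r s) (g : el_hom q r) (f : el_hom p q) :
  el_cmp h (el_cmp g f) = el_cmp (el_cmp h g) f.
Proof. by apply: sval_inj; exact: cmpA. Qed.
Lemma el_id_tr : exists e, forall p n, n ||- p -> yields e n (el_id p).
Proof.
have [e He] := idm_tr D; exists (code (App (Cst e) (Fst Arg))).
move=> p n [a [b [-> Ha Hb]]]; have [m [k r]] := He _ _ Ha.
by exists m; split=> //; run.
Qed.
Lemma el_cmp_tr : exists e, forall p q r (g : el_hom q r) (f : el_hom p q) np nq nr ng nf,
    np ||- p -> nq ||- q -> nr ||- r -> ng ||- g -> nf ||- f ->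
    yields e << np, nq, nr, ng, nf >> (el_cmp g f).
Proof.
have [e He] := cmp_tr D.
exists (code (App (Cst e) (Pair (Fst (Pj0 Arg)) (Pair (Fst (Pj1 Arg)) (Pair (Fst (Pj2 Arg)) (Tl3 Arg)))))).
move=> p q r g f np nq nr ng nf [a [a' [-> Ha _]]] [b [b' [-> Hb _]]] [c [c' [-> Hc _]]] Hg Hf.
have [m [k rm]] := He _ _ _ _ _ _ _ _ _ _ Ha Hb Hc Hg Hf.
by exists m; split=> //; run.
Qed.
Definition El : icat :=
  @ICat el_ob el_hom el_id el_cmp el_cmp1m el_cmpm1 el_cmpA el_id_tr el_cmp_tr.

Definition elhom x y (f : hom x y) (a : A y) (a' : A x) (e : res A f a = a') :
  @hom El (x; a') (y; a) := exist _ f e.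

Lemma proj_ob_tr : exists e, forall (x : ob El) n, n ||- x -> yields e n (projT1 x).
Proof.
by exists (code (Fst Arg)) => x n [a [b [-> Ha _]]]; apply: yieldsI Ha; run.
Qed.
Lemma proj_hom_tr : exists e, forall (x y : ob El) (f : hom x y) nx ny nf,
    nx ||- x -> ny ||- y -> nf ||- f -> yields e << nx, ny, nf >> (sval f).
Proof. by exists (code (Tl2 Arg)) => x y f nx ny nf _ _ Hf; apply: yieldsI Hf; run. Qed.
Definition proj : ifun El D :=
  @IFun El D (fun x => projT1 x) (fun _ _ f => sval f) (fun _ => erefl)
    (fun _ _ _ _ _ => erefl) proj_ob_tr proj_hom_tr.
End El.
Arguments proj {D} A.
Arguments elhom {D A x y} f {a a'} e.

Section ElMap.
Variables (D : icat) (A B : psh D) (s : nt A B).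
Definition elmap_ob (p : ob (El A)) : ob (El B) := (projT1 p; s _ (projT2 p)).
Lemma elmap_ax (p q : ob (El A)) (f : hom p q) : res B (sval f) (projT2 (elmap_ob q)) = projT2 (elmap_ob p).
Proof. by rewrite /= -nt_nat (svalP f). Qed.
Definition elmap_hom (p q : ob (El A)) (f : hom p q) : hom (elmap_ob p) (elmap_ob q) :=
  exist _ (sval f) (elmap_ax f).
Lemma elmap1 (p : ob (El A)) : elmap_hom (idm p) = idm (elmap_ob p).
Proof. exact: sval_inj. Qed.
Lemma elmapM (p q r : ob (El A)) (g : hom q r) (f : hom p q) :
  elmap_hom (cmp g f) = cmp (elmap_hom g) (elmap_hom f).
Proof. exact: sval_inj. Qed.
Lemma elmap_ob_tr : exists e, forall (p : ob (El A)) n, n ||- p -> yields e n (elmap_ob p).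
Proof.
have [e He] := nt_tr s; exists (code (Pair (Fst Arg) (App (Cst e) Arg))).
move=> p n [a [b [-> Ha Hb]]]; have [m [k r]] := He _ _ _ _ Ha Hb.
by exists << a, m >>; split; [run | exists a, m].
Qed.
Lemma elmap_hom_tr : exists e, forall (p q : ob (El A)) (f : hom p q) np nq nf,
    np ||- p -> nq ||- q -> nf ||- f -> yields e << np, nq, nf >> (elmap_hom f).
Proof. by exists (code (Tl2 Arg)) => p q f np nq nf _ _ Hf; exists nf; split=> //; run. Qed.
Definition elmap : ifun (El A) (El B) := IFun elmap1 elmapM elmap_ob_tr elmap_hom_tr.
End ElMap.

Section IFunComp.
Variables (D E H : icat) (G : ifun E H) (F : ifun D E).
Lemma fcomp_ob_tr : exists e, forall x n, n ||- x -> yields e n (G (F x)).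
Proof.
have [e He] := fob_tr F; have [e' He'] := fob_tr G.
exists (code (App (Cst e') (App (Cst e) Arg))) => x n Hx.
have [m [k r]] := He _ _ Hx; have [m' [k' r']] := He' _ _ r.
by apply: yieldsI r'; run.
Qed.
Lemma fcomp_hom_tr : exists e, forall x y (f : hom x y) nx ny nf,
    nx ||- x -> ny ||- y -> nf ||- f -> yields e << nx, ny, nf >> (fhom G (fhom F f)).
Proof.
have [e He] := fob_tr F; have [e1 He1] := fhom_tr F; have [e2 He2] := fhom_tr G.
exists (code (App (Cst e2) (Pair (App (Cst e) (Pj0 Arg)) (Pair (App (Cst e) (Pj1 Arg))
  (App (Cst e1) Arg))))) => x y f nx ny nf Hx Hy Hf.
have [mx [kx rx]] := He _ _ Hx; have [my [ky ry]] := He _ _ Hy.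
have [mf [kf rf]] := He1 _ _ _ _ _ _ Hx Hy Hf; have [m [k r]] := He2 _ _ _ _ _ _ rx ry rf.
by apply: yieldsI r; run.
Qed.
Lemma fcomp1 x : fhom G (fhom F (idm x)) = idm (G (F x)).
Proof. by rewrite !fhom1. Qed.
Lemma fcompM x y z (g : hom y z) (f : hom x y) :
  fhom G (fhom F (cmp g f)) = cmp (fhom G (fhom F g)) (fhom G (fhom F f)).
Proof. by rewrite !fhomM. Qed.
Definition fcomp : ifun D H := @IFun D H (fun x => G (F x)) _ fcomp1 fcompM fcomp_ob_tr fcomp_hom_tr.
End IFunComp.

Section Subst.
Variables (D E : icat) (F : ifun D E) (A : psh E).
Lemma subst_tr : exists e, forall x y (f : hom x y) (a : A (F y)) nx ny nf na,
    nx ||- x -> ny ||- y -> nf ||- f -> na ||- a ->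
    yields e << nx, ny, nf, na >> (res A (fhom F f) a).
Proof.
have [e He] := fob_tr F; have [e1 He1] := fhom_tr F; have [e2 He2] := res_tr A.
exists (code (App (Cst e2) (Pair (App (Cst e) (Pj0 Arg)) (Pair (App (Cst e) (Pj1 Arg))
  (Pair (App (Cst e1) (Pair (Pj0 Arg) (Pair (Pj1 Arg) (Pj2 Arg)))) (Tl3 Arg)))))).
move=> x y f a nx ny nf na Hx Hy Hf Ha.
have [mx [kx rx]] := He _ _ Hx; have [my [ky ry]] := He _ _ Hy.
have [mf [kf rf]] := He1 _ _ _ _ _ _ Hx Hy Hf.
have [m [k r]] := He2 _ _ _ _ _ _ _ _ rx ry rf Ha.
by apply: yieldsI r; run.
Qed.
Lemma subst1 x (a : A (F x)) : res A (fhom F (idm x)) a = a.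
Proof. by rewrite fhom1 res1. Qed.
Lemma substM x y z (g : hom y z) (f : hom x y) (a : A (F z)) :
  res A (fhom F (cmp g f)) a = res A (fhom F f) (res A (fhom F g) a).
Proof. by rewrite fhomM resM. Qed.
Definition subst : psh D :=
  @Psh D (fun x => A (F x)) (fun _ _ f a => res A (fhom F f) a) subst1 substM subst_tr.

Definition lift_ob (p : ob (El subst)) : ob (El A) := (F (projT1 p); projT2 p).
Definition lift_hom (p q : ob (El subst)) (f : hom p q) : hom (lift_ob p) (lift_ob q) :=
  exist _ (fhom F (sval f)) (svalP f).
Lemma lift1 (p : ob (El subst)) : lift_hom (idm p) = idm (lift_ob p).
Proof. by apply: sval_inj; exact: fhom1. Qed.
Lemma liftM (p q r : ob (El subst)) (g : hom q r) (f : hom p q) :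
  lift_hom (cmp g f) = cmp (lift_hom g) (lift_hom f).
Proof. by apply: sval_inj; exact: fhomM. Qed.
Lemma lift_ob_tr : exists e, forall (p : ob (El subst)) n, n ||- p -> yields e n (lift_ob p).
Proof.
have [e He] := fob_tr F; exists (code (Pair (App (Cst e) (Fst Arg)) (Snd Arg))).
move=> p n [a [b [-> Ha Hb]]]; have [m [k r]] := He _ _ Ha.
by exists << m, b >>; split; [run | exists m, b].
Qed.
Lemma lift_hom_tr : exists e, forall (p q : ob (El subst)) (f : hom p q) np nq nf,
    np ||- p -> nq ||- q -> nf ||- f -> yields e << np, nq, nf >> (lift_hom f).
Proof.
have [e He] := fhom_tr F.
exists (code (App (Cst e) (Pair (Fst (Pj0 Arg)) (Pair (Fst (Pj1 Arg)) (Tl2 Arg))))).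
move=> p q f np nq nf [a [a' [-> Ha _]]] [b [b' [-> Hb _]]] Hf.
have [m [k r]] := He _ _ _ _ _ _ Ha Hb Hf.
by exists m; split=> //; run.
Qed.
Definition lift : ifun (El subst) (El A) := IFun lift1 liftM lift_ob_tr lift_hom_tr.

Lemma tmsub_ax (s : tm A) : @tm_ax D subst (fun x => sval s (F x)).
Proof.
case: s => s [sn [e He]]; split=> [x y f|] /=; first exact: sn.
have [e' He'] := fob_tr F; exists (code (App (Cst e) (App (Cst e') Arg))) => x n Hx.
have [m [k r]] := He' _ _ Hx; have [m' [k' r']] := He _ _ r.
by apply: yieldsI r'; run.
Qed.
Definition tmsub (s : tm A) : tm subst := exist _ _ (tmsub_ax s).
End Subst.
Arguments subst {D E} F A.
Arguments lift {D E} F A.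
Arguments tmsub {D E} F {A} s.

Section Var.
Variables (D : icat) (A : psh D).
Lemma var_ax : @tm_ax (El A) (subst (proj A) A) (fun p => projT2 p).
Proof.
split=> [p q f|]; first by rewrite /= (svalP f).
by exists (code (Snd Arg)) => p n [a [b [-> _ Hb]]]; apply: yieldsI Hb; run.
Qed.
Definition var : tm (subst (proj A) A) := exist _ _ var_ax.
End Var.
Arguments var {D} A.

Section Pi.
Variables (D : icat) (A : psh D) (B : psh (El A)).
Definition pi_fam (x : ob D) := forall y (f : hom y x) (a : A y), B (y; a).
Definition pi_nat x (t : pi_fam x) :=
  forall y z (f : hom y x) (g : hom z y) (a : A y),
    t z (cmp f g) (res A g a) = res B (elhom g erefl) (t y f a).
Definition pi_rz (e : nat) x (t : pi_fam x) :=
  forall y (f : hom y x) (a : A y) ny nf na, ny ||- y -> nf ||- f -> na ||- a ->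
    yields e << ny, nf, na >> (t y f a).
Definition piA (x : ob D) : asm :=
  @Asm {t : pi_fam x | pi_nat t /\ exists e, pi_rz e t} (fun e t => pi_rz e (sval t))
       (fun t => proj2 (svalP t)).
Definition pi_res_fam x y (h : hom x y) (t : pi_fam y) : pi_fam x :=
  fun z f a => t z (cmp h f) a.
Lemma pi_res_rz : exists e, forall x y (h : hom x y) (t : pi_fam y) nx ny nh nt,
  nx ||- x -> ny ||- y -> nh ||- h -> pi_rz nt t ->
  exists m, kapp e << nx, ny, nh, nt >> m /\ pi_rz m (pi_res_fam h t).
Proof.
have [c Hc] := cmp_tr D.
pose body := App (Tl3 (Fst Arg))
  (Pair (Pj0 (Snd Arg)) (Pair (App (Cst c)
    (Pair (Pj0 (Snd Arg)) (Pair (Pj0 (Fst Arg)) (Pair (Pj1 (Fst Arg))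
      (Pair (Pj2 (Fst Arg)) (Pj1 (Snd Arg))))))) (Tl2 (Snd Arg)))).
exists (code (Lam body)) => x y h t nx ny nh nt Hx Hy Hh Ht.
eexists; split; first by run.
move=> z f a nz nf na Hz Hf Ha.
have [m [k r]] := Hc _ _ _ _ _ _ _ _ _ _ Hz Hx Hy Hh Hf.
have [m' [k' r']] := Ht _ _ _ _ _ _ Hz r Ha.
by apply: yieldsI r'; run.
Qed.
Lemma pi_res_ax x y (h : hom x y) (t : piA y) :
  pi_nat (pi_res_fam h (sval t)) /\ exists e, pi_rz e (pi_res_fam h (sval t)).
Proof.
case: t => t [tn [nt Ht]]; split=> /=.
  by move=> z w f g a; rewrite /pi_res_fam cmpA tn.
have [e He] := pi_res_rz.
have [nx Hx] := rz_ex x; have [ny Hy] := rz_ex y; have [nh Hh] := rz_ex h.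
by have [m [_ Hm]] := He _ _ _ _ _ _ _ _ Hx Hy Hh Ht; exists m.
Qed.
Definition pi_res x y (h : hom x y) (t : piA y) : piA x := exist _ _ (pi_res_ax h t).
Lemma pi_ext x (s t : piA x) : (forall y f a, sval s y f a = sval t y f a) -> s = t.
Proof.
move=> st; apply: sval_inj; apply: functional_extensionality_dep => y.
by apply: functional_extensionality_dep => f; apply: functional_extensionality_dep.
Qed.
Lemma pi_res1 x (t : piA x) : pi_res (idm x) t = t.
Proof. by apply: pi_ext => y f a; rewrite /= /pi_res_fam cmp1m. Qed.
Lemma pi_resM x y z (g : hom y z) (f : hom x y) (t : piA z) :
  pi_res (cmp g f) t = pi_res f (pi_res g t).
Proof. by apply: pi_ext => w h a; rewrite /= /pi_res_fam cmpA. Qed.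
Lemma pi_res_tr : exists e, forall x y (h : hom x y) (t : piA y) nx ny nh nt,
  nx ||- x -> ny ||- y -> nh ||- h -> nt ||- t ->
  yields e << nx, ny, nh, nt >> (pi_res h t).
Proof. by have [e He] := pi_res_rz; exists e => x y h t; exact: He. Qed.
Definition Pi : psh D := Psh pi_res1 pi_resM pi_res_tr.
End Pi.

Definition arr (D : icat) (A B : psh D) : psh D := Pi (subst (proj A) B).

(* [t a], for t and a in a context D' over D. *)
Section PApp.
Variables (D D' : icat) (F : ifun D' D) (A B : psh D).
Variables (t : tm (subst F (arr A B))) (a : tm (subst F A)).
Definition papp_fun (x : ob D') : B (F x) := sval (sval t x) (F x) (idm _) (sval a x).
Lemma papp_ax : @tm_ax D' (subst F B) papp_fun.
Proof.
have [tn [et Ht]] := svalP t; have [an [ea Ha]] := svalP a; split=> [x y f|].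
  rewrite /papp_fun (tn _ _ f) (an _ _ f) /= /pi_res_fam cmpm1 -{1}(cmp1m (fhom F f)).
  by have [tn' _] := svalP (sval t y); rewrite tn'.
have [eF HF] := fob_tr F; have [ei Hi] := idm_tr D.
exists (code (App (App (Cst et) Arg) (Pair (App (Cst eF) Arg)
  (Pair (App (Cst ei) (App (Cst eF) Arg)) (App (Cst ea) Arg))))) => x n Hx.
have [m1 [k1 r1]] := Ht _ _ Hx; have [m2 [k2 r2]] := HF _ _ Hx.
have [m3 [k3 r3]] := Hi _ _ r2; have [m4 [k4 r4]] := Ha _ _ Hx.
have [m5 [k5 r5]] := r1 _ _ _ _ _ _ r2 r3 r4.
by apply: yieldsI r5; run.
Qed.
Definition papp : tm (subst F B) := exist _ papp_fun papp_ax.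
End PApp.

Lemma exT_res (D : icat) (A : psh D) (B : psh (El A)) x y (f : hom x y) (a : A y)
    (b : B (y; a)) (a' : A x) (e : res A f a = a') :
  existT (fun a => B (x; a)) a' (res B (elhom f e) b) =
  existT (fun a => B (x; a)) (res A f a) (res B (elhom f erefl) b).
Proof. by case: _ / e. Qed.

Section Sig.
Variables (D : icat) (A : psh D) (B : psh (El A)).
Definition sg (x : ob D) : asm := sigA (fun a : A x => B (x; a)).
Definition sg_res x y (f : hom x y) (p : sg y) : sg x :=
  (res A f (projT1 p); res B (elhom f erefl) (projT2 p)).
Lemma sg_res1 x (p : sg x) : sg_res (idm x) p = p.
Proof.
case: p => a b; rewrite /sg_res /= -(exT_res b (res1 a)); congr existT.
by rewrite -[RHS](res1 (p := B)); congr (res B _ b); exact: sval_inj.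
Qed.
Lemma sg_resM x y z (g : hom y z) (f : hom x y) (p : sg z) :
  sg_res (cmp g f) p = sg_res f (sg_res g p).
Proof.
case: p => a b; rewrite /sg_res /= -(exT_res b (resM g f a)); congr existT.
by rewrite -(resM (p := B)); congr (res B _ b); exact: sval_inj.
Qed.
Lemma sg_res_tr : exists e, forall x y (f : hom x y) (p : sg y) nx ny nf np,
  nx ||- x -> ny ||- y -> nf ||- f -> np ||- p ->
  yields e << nx, ny, nf, np >> (sg_res f p).
Proof.
have [ea Ha] := res_tr A; have [eb Hb] := res_tr B.
pose ra := App (Cst ea) (Pair (Pj0 Arg) (Pair (Pj1 Arg) (Pair (Pj2 Arg) (Fst (Tl3 Arg))))).
exists (code (Pair ra (App (Cst eb) (Pair (Pair (Pj0 Arg) ra)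
  (Pair (Pair (Pj1 Arg) (Fst (Tl3 Arg))) (Pair (Pj2 Arg) (Snd (Tl3 Arg)))))))).
move=> x y f [a b] nx ny nf np Hx Hy Hf [na [nb [-> /= Hna Hnb]]].
have [m [k r]] := Ha _ _ _ _ _ _ _ _ Hx Hy Hf Hna.
have Hx' : << nx, m >> ||- (existT _ x (res A f a) : ob (El A)) by exists nx, m.
have Hy' : << ny, na >> ||- (existT _ y a : ob (El A)) by exists ny, na.
have [m' [k' r']] := Hb _ _ (elhom f erefl) _ _ _ _ _ Hx' Hy' Hf Hnb.
by exists << m, m' >>; split; [run | exists m, m'].
Qed.
Definition Sig : psh D := Psh sg_res1 sg_resM sg_res_tr.
Lemma sg_fst_tr : exists e, forall x (p : Sig x) nx np,
  nx ||- x -> np ||- p -> yields e << nx, np >> (projT1 p).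
Proof.
by exists (code (Fst (Snd Arg))) => x p nx np _ [a [b [-> Ha _]]]; apply: yieldsI Ha; run.
Qed.
Definition sg_fst : nt Sig A :=
  @NT D Sig A (fun _ p => projT1 p) (fun _ _ _ _ => erefl) sg_fst_tr.
End Sig.

Section Sub.
Variables (D : icat) (A : psh D) (P : forall x, A x -> Prop).
Hypothesis P_res : forall x y (f : hom x y) a, P a -> P (res A f a).
Definition sub_res x y (f : hom x y) (a : subA (@P y)) : subA (@P x) :=
  exist _ (res A f (sval a)) (P_res f (svalP a)).
Lemma sub_res1 x (a : subA (@P x)) : sub_res (idm x) a = a.
Proof. by apply: sval_inj; exact: res1. Qed.
Lemma sub_resM x y z (g : hom y z) (f : hom x y) (a : subA (@P z)) :
  sub_res (cmp g f) a = sub_res f (sub_res g a).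
Proof. by apply: sval_inj; exact: resM. Qed.
Lemma sub_res_tr : exists e, forall x y (f : hom x y) (a : subA (@P y)) nx ny nf na,
  nx ||- x -> ny ||- y -> nf ||- f -> na ||- a ->
  yields e << nx, ny, nf, na >> (sub_res f a).
Proof. by have [e He] := res_tr A; exists e => x y f a; exact: He. Qed.
Definition Sub : psh D := Psh sub_res1 sub_resM sub_res_tr.
End Sub.

Section One.
Variable D : icat.
Lemma one_tr : exists e, forall (x y : ob D) (f : hom x y) (a : propA True) nx ny nf na,
  nx ||- x -> ny ||- y -> nf ||- f -> na ||- a ->
  yields e << nx, ny, nf, na >> (a : propA True).
Proof. by exists (c_cst 0) => *; exists 0; split=> //; constructor. Qed.
Definition one : psh D :=
  @Psh D (fun=> propA True) (fun _ _ _ a => a) (fun _ _ => erefl) (fun _ _ _ _ _ _ => erefl) one_tr.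
Lemma to_one_tr (A : psh D) : exists e, forall x (a : A x) nx na,
  nx ||- x -> na ||- a -> yields e << nx, na >> (I : one x).
Proof. by exists (c_cst 0) => *; exists 0; split=> //; constructor. Qed.
Definition to_one (A : psh D) : nt A one :=
  @NT D A one (fun _ _ => I) (fun _ _ _ _ => erefl) (to_one_tr A).
End One.

Section Yoneda.
Variable C : icat.
Lemma yo_tr (c : ob C) : exists e, forall (x y : ob C) (f : hom x y) (a : hom y c) nx ny nf na,
  nx ||- x -> ny ||- y -> nf ||- f -> na ||- a ->
  yields e << nx, ny, nf, na >> (cmp a f).
Proof.
have [e He] := cmp_tr C; have [nc Hc] := rz_ex c.
exists (code (App (Cst e) (Pair (Pj0 Arg) (Pair (Pj1 Arg) (Pair (Cst nc) (Pair (Tl3 Arg) (Pj2 Arg))))))).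
move=> x y f a nx ny nf na Hx Hy Hf Ha.
have [m [k r]] := He _ _ _ _ _ _ _ _ _ _ Hx Hy Hc Ha Hf.
by apply: yieldsI r; run.
Qed.
Definition yo (c : ob C) : psh C :=
  @Psh C (fun d => hom d c) (fun _ _ f a => cmp a f) (fun _ a => cmpm1 a)
    (fun _ _ _ g f a => cmpA a g f) (yo_tr c).
Lemma yo_map_tr (c d : ob C) (h : hom c d) : exists e, forall x (a : yo c x) nx na,
  nx ||- x -> na ||- a -> yields e << nx, na >> (cmp h a : yo d x).
Proof.
have [e He] := cmp_tr C; have [nc Hc] := rz_ex c; have [nd Hd] := rz_ex d.
have [nh Hh] := rz_ex h.
exists (code (App (Cst e) (Pair (Fst Arg) (Pair (Cst nc) (Pair (Cst nd) (Pair (Cst nh) (Snd Arg))))))).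
move=> x a nx na Hx Ha.
have [m [k r]] := He _ _ _ _ _ _ _ _ _ _ Hx Hc Hd Hh Ha.
by apply: yieldsI r; run.
Qed.
Definition yo_map (c d : ob C) (h : hom c d) : nt (yo c) (yo d) :=
  @NT C (yo c) (yo d) (fun _ a => cmp h a) (fun _ _ f a => cmpA h a f) (yo_map_tr h).
Lemma yo_map1 (c : ob C) : yo_map (idm c) = nt_id (yo c).
Proof. by apply: nt_eq => x a; exact: cmp1m. Qed.
Lemma yo_mapM (c d e : ob C) (g : hom d e) (f : hom c d) :
  yo_map (cmp g f) = nt_cmp (yo_map g) (yo_map f).
Proof. by apply: nt_eq => x a; rewrite /= cmpA. Qed.
End Yoneda.

Record univ := Univ { uob :> asm; uel : uob -> asm }.

(* Internal presheaves on D with values in the universe V. *)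
Record ufun (V : univ) (D : icat) := UFun {
  ucode :> ob D -> V;
  uact : forall x y, hom x y -> uel (ucode y) -> uel (ucode x);
  uact1 : forall x a, uact (idm x) a = a;
  uactM : forall x y z (g : hom y z) (f : hom x y) a, uact (cmp g f) a = uact f (uact g a);
  ucode_tr : exists e, forall x n, n ||- x -> yields e n (ucode x);
  uact_tr : exists e, forall x y (f : hom x y) (a : uel (ucode y)) nx ny nf na,
    nx ||- x -> ny ||- y -> nf ||- f -> na ||- a ->
    yields e << nx, ny, nf, na >> (uact f a) }.
Arguments uact {V D} u {x y}.

Definition upsh (V : univ) (D : icat) (F : ufun V D) : psh D :=
  @Psh D (fun x => uel (F x)) (fun _ _ f => uact F f) (@uact1 V D F) (@uactM V D F) (uact_tr F).

Definition ufun_rz (V : univ) (D : icat) (n : nat) (F : ufun V D) :=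
  exists a b, [/\ n = << a, b >>,
    (forall x m, m ||- x -> yields a m (F x)) &
    (forall x y (f : hom x y) (u : uel (F y)) nx ny nf nu,
      nx ||- x -> ny ||- y -> nf ||- f -> nu ||- u ->
      yields b << nx, ny, nf, nu >> (uact F f u))].
Lemma ufun_rz_ex (V : univ) (D : icat) (F : ufun V D) : exists n, ufun_rz n F.
Proof.
by have [a Ha] := ucode_tr F; have [b Hb] := uact_tr F; exists << a, b >>, a, b.
Qed.
Definition ufunA (V : univ) (D : icat) : asm := Asm (@ufun_rz_ex V D).

Lemma ufun_ext (V : univ) (D : icat) (F G : ufun V D) (e : forall x, F x = G x) :
  (forall x y f a, eq_rect _ (fun u => uel u) (uact F f a) _ (e x) =
                   uact G f (eq_rect _ (fun u => uel u) a _ (e y)) :> uel (G x)) -> F = G.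
Proof.
case: F G e => u act a1 aM t1 t2 [u' act' a1' aM' t1' t2'] /= e.
have eu : u = u' by apply: funext.
case: _ / eu act' a1' aM' t1' t2' e => act' a1' aM' t1' t2' e.
have -> : e = fun=> erefl by exact: Prop_irrelevance.
move=> /= eact.
have ea : act = act'.
  apply: functional_extensionality_dep => x; apply: functional_extensionality_dep => y.
  by apply: funext => f; apply: funext => a; exact: eact.
case: _ / ea a1' aM' t1' t2' eact => a1' aM' t1' t2' _.
by congr UFun; exact: Prop_irrelevance.
Qed.

Definition uprecomp (V : univ) (D E : icat) (F : ufun V E) (G : ifun D E) : ufun V D.
Proof.
exists (fun x => F (G x)) (fun _ _ f => uact F (fhom G f)).
- exact: (@res1 _ (subst G (upsh F))).
- exact: (@resM _ (subst G (upsh F))).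
- have [e He] := ucode_tr F; have [e' He'] := fob_tr G.
  exists (code (App (Cst e) (App (Cst e') Arg))) => x n Hx.
  have [m [k r]] := He' _ _ Hx; have [m' [k' r']] := He _ _ r.
  by apply: yieldsI r'; run.
- exact: (@res_tr _ (subst G (upsh F))).
Defined.

Section HS.
Variables (C : icat) (V : univ).
Definition hs_ob (c : ob C) : asm := ufunA V (El (yo c)).
Definition hs_res c d (f : hom c d) (F : hs_ob d) : hs_ob c :=
  uprecomp F (elmap (yo_map f)).

Lemma uprecomp_id c (F : hs_ob c) : uprecomp F (elmap (nt_id (yo c))) = F.
Proof.
have e (x : ob (El (yo c))) : (uprecomp F (elmap (nt_id (yo c)))) x = F x by case: x.
apply: (@ufun_ext _ _ _ _ e) => -[x a] [y b] f u.
rewrite (Prop_irrelevance (e (x; a)) erefl) (Prop_irrelevance (e (y; b)) erefl) /=.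
by congr (uact F _ u); exact: sval_inj.
Qed.
Lemma uprecomp_cmp (A B E : psh C) (F : ufun V (El E)) (t : nt B E) (s : nt A B) :
  uprecomp F (elmap (nt_cmp t s)) = uprecomp (uprecomp F (elmap t)) (elmap s).
Proof.
have e (x : ob (El A)) : (uprecomp F (elmap (nt_cmp t s))) x =
  (uprecomp (uprecomp F (elmap t)) (elmap s)) x by [].
apply: (@ufun_ext _ _ _ _ e) => x y f u.
rewrite (Prop_irrelevance (e x) erefl) (Prop_irrelevance (e y) erefl) /=.
by congr (uact F _ u); exact: sval_inj.
Qed.
Lemma hs_res1 c (F : hs_ob c) : hs_res (idm c) F = F.
Proof. by rewrite /hs_res yo_map1 uprecomp_id. Qed.
Lemma hs_resM c d e (g : hom d e) (f : hom c d) (F : hs_ob e) :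
  hs_res (cmp g f) F = hs_res f (hs_res g F).
Proof. by rewrite /hs_res yo_mapM uprecomp_cmp. Qed.
Lemma hs_res_tr : exists e, forall c d (f : hom c d) (F : hs_ob d) nc nd nf nF,
  nc ||- c -> nd ||- d -> nf ||- f -> nF ||- F ->
  yields e << nc, nd, nf, nF >> (hs_res f F).
Proof.
have [e He] := cmp_tr C.
(* (x, a) |-> (x, f a), with << nc, nd, nf, nF >> given by o *)
pose mob o t := Pair (Fst t) (App (Cst e) (Pair (Fst t) (Pair (Pj0 o) (Pair (Pj1 o)
  (Pair (Pj2 o) (Snd t)))))).
pose b1 := App (Fst (Tl3 (Fst Arg))) (mob (Fst Arg) (Snd Arg)).
pose b2 := App (Snd (Tl3 (Fst Arg))) (Pair (mob (Fst Arg) (Pj0 (Snd Arg)))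
  (Pair (mob (Fst Arg) (Pj1 (Snd Arg))) (Tl2 (Snd Arg)))).
exists (code (Pair (Lam b1) (Lam b2))) => c d f F nc nd nf nF Hc Hd Hf [a [b [-> Ha Hb]]].
eexists; split; first by run.
do 2 eexists; split; first reflexivity.
- move=> x m [n1 [n2 [-> H1 H2]]].
  have [m1 [k1 r1]] := He _ _ _ _ _ _ _ _ _ _ H1 Hc Hd Hf H2.
  have H : << n1, m1 >> ||- (elmap (yo_map f) x) by exists n1, m1.
  have [m2 [k2 r2]] := Ha _ _ H.
  by apply: yieldsI r2; run.
- move=> x y g u nx ny ng nu [n1 [n2 [-> H1 H2]]] [n3 [n4 [-> H3 H4]]] Hg Hu.
  have [m1 [k1 r1]] := He _ _ _ _ _ _ _ _ _ _ H1 Hc Hd Hf H2.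
  have [m2 [k2 r2]] := He _ _ _ _ _ _ _ _ _ _ H3 Hc Hd Hf H4.
  have Hx : << n1, m1 >> ||- (elmap (yo_map f) x) by exists n1, m1.
  have Hy : << n3, m2 >> ||- (elmap (yo_map f) y) by exists n3, m2.
  have [m3 [k3 r3]] := Hb _ _ (fhom (elmap (yo_map f)) g) u _ _ _ _ Hx Hy Hg Hu.
  by apply: yieldsI r3; run.
Qed.
(* [C^op, V] *)
Definition HS : psh C := Psh hs_res1 hs_resM hs_res_tr.

Definition hs_el_at (p : ob (El HS)) : asm := uel (projT2 p (projT1 p; idm (projT1 p))).
Lemma hs_el_ax (c d : ob C) (f : hom c d) : res (yo d) f (idm d) = cmp f (idm c).
Proof. by rewrite /= cmp1m cmpm1. Qed.
(* The result is cast along the equation F|f = G carried by a morphism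
   f : (c,G) -> (d,F) of El HS. *)
Definition hs_act (c d : ob C) (f : hom c d) (F : HS d) (G : HS c) (E : res HS f F = G)
    (a : uel (F (d; idm d))) : uel (G (c; idm c)) :=
  eq_rect (res HS f F) (fun G : HS c => uel (G (c; idm c)))
    (uact F (elhom f (hs_el_ax f)) a) G E.
Definition hs_el_res (p q : ob (El HS)) (f : hom p q) (a : hs_el_at q) : hs_el_at p :=
  hs_act (svalP f) a.

Lemma hs_cast (c : ob C) (F G : HS c) (E : F = G) (w : uel (F (c; idm c)))
    (e : F (c; idm c) = G (c; idm c)) :
  eq_rect F (fun G : HS c => uel (G (c; idm c))) w G E = eq_rect _ (fun u => uel u) w _ e.
Proof. by case: _ / E e => e; rewrite (Prop_irrelevance e erefl). Qed.
Lemma uact_id (D : icat) (F : ufun V D) (x : ob D) (k : hom x x) a : k = idm x -> uact F k a = a.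
Proof. by move=> ->; exact: uact1. Qed.
Lemma uact_cast (c d : ob C) (F : HS c) (h h' : yo c d) (e : h' = h)
    (p : res (yo c) (idm d) h = h') (e' : F (d; h) = F (d; h')) (w : uel (F (d; h))) :
  eq_rect _ (fun u => uel u) w _ e' = uact F (elhom (idm d) p) w.
Proof.
case: _ / (esym e) p e' => p e'; rewrite (Prop_irrelevance e' erefl) /= uact_id //.
exact: sval_inj.
Qed.

Lemma hs_el_res1 p (a : hs_el_at p) : hs_el_res (idm p) a = a.
Proof.
case: p a => c F a; rewrite /hs_el_res /hs_act /=.
have e : idm c = cmp (idm c) (idm c) by rewrite cmp1m.
have e' : F (c; cmp (idm c) (idm c)) = F (c; idm c) by rewrite -e.
have q : res (yo c) (idm c) (cmp (idm c) (idm c)) = idm c by rewrite /= !cmp1m.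
refine (etrans (@hs_cast c (hs_res (idm c) F) F _ _ e') _).
refine (etrans (@uact_cast c c F _ _ e q e' _) _).
rewrite -uactM; apply: uact_id; apply: sval_inj; exact: cmp1m.
Qed.
Lemma hs_actM (c d z : ob C) (g : hom d z) (f : hom c d) (F : HS z) (G : HS d) (H : HS c)
    (eg : res HS g F = G) (ef : res HS f G = H) (E : res HS (cmp g f) F = H) a :
  hs_act E a = hs_act ef (hs_act eg a).
Proof.
case: _ / eg ef E => /= ef; case: _ / ef => E /=; rewrite /hs_act /=.
have e : cmp g (cmp f (idm c)) = cmp (cmp g f) (idm c) by rewrite cmpA.
have e' : F (c; cmp (cmp g f) (idm c)) = F (c; cmp g (cmp f (idm c))) by rewrite e.
have k : res (yo z) (idm c) (cmp (cmp g f) (idm c)) = cmp g (cmp f (idm c)).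
  by rewrite /= !cmpm1.
refine (etrans (@hs_cast c (hs_res (cmp g f) F) (hs_res f (hs_res g F)) E _ e') _).
refine (etrans (@uact_cast z c F _ _ e k e' _) _).
rewrite -!uactM.
by congr (uact F _ a); apply: sval_inj; rewrite /= cmpm1.
Qed.
Lemma hs_el_resM (p q r : ob (El HS)) (g : hom q r) (f : hom p q) (a : hs_el_at r) :
  hs_el_res (cmp g f) a = hs_el_res f (hs_el_res g a).
Proof. exact: hs_actM. Qed.
Lemma hs_act_rz (c d : ob C) (f : hom c d) (F : HS d) (G : HS c) (E : res HS f F = G)
    (a : uel (F (d; idm d))) m :
  m ||- uact F (elhom f (hs_el_ax f)) a -> m ||- hs_act E a.
Proof. by case: _ / E. Qed.
Lemma hs_el_tr : exists e, forall (p q : ob (El HS)) (f : hom p q) (a : hs_el_at q) np nq nf na,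
  np ||- p -> nq ||- q -> nf ||- f -> na ||- a ->
  yields e << np, nq, nf, na >> (hs_el_res f a).
Proof.
have [e He] := cmp_tr C; have [ei Hi] := idm_tr C.
pose nc := Fst (Pj0 Arg); pose nd := Fst (Pj1 Arg).
exists (code (App (Snd (Snd (Pj1 Arg))) (Pair (Pair nc (App (Cst e) (Pair nc (Pair nc (Pair nd
  (Pair (Pj2 Arg) (App (Cst ei) nc))))))) (Pair (Pair nd (App (Cst ei) nd)) (Tl2 Arg))))).
move=> [c G] [d F] [f ef] a np nq nf na [n1 [n2 [-> H1 _]]].
move=> [n3 [n4 [-> H3 [e1 [e2 [-> _ He2]]]]]] Hf Ha.
simpl in *.
have [m1 [k1 r1]] := Hi _ _ H1; have [m2 [k2 r2]] := Hi _ _ H3.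
have [m3 [k3 r3]] := He _ _ _ _ _ _ _ _ _ _ H1 H1 H3 Hf r1.
have Hx : << n1, m3 >> ||- ((c; cmp f (idm c)) : ob (El (yo d))) by exists n1, m3.
have Hy : << n3, m2 >> ||- ((d; idm d) : ob (El (yo d))) by exists n3, m2.
have [m4 [k4 r4]] := He2 _ _ (elhom f (hs_el_ax f)) a _ _ _ _ Hx Hy Hf Ha.
exists m4; split; first by run.
exact: hs_act_rz.
Qed.
Definition hs_el : psh (El HS) := Psh hs_el_res1 hs_el_resM hs_el_tr.
End HS.

(* PER: every natural number realizes every partial equivalence relation. *)
Definition is_per (R : nat -> nat -> Prop) :=
  (forall m n, R m n -> R n m) /\ (forall m n k, R m n -> R n k -> R m k).
Definition perA : asm := @Asm {R | is_per R} (fun _ _ => True) (fun _ => ex_intro _ 0 I).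
(* N/R: a class is a subset of N, realized by its elements. *)
Definition is_class (R : nat -> nat -> Prop) (S : nat -> Prop) :=
  exists2 n, R n n & forall m, S m <-> R n m.
Lemma class_rz_ex R (S : {S | is_class R S}) : exists n, sval S n.
Proof. by case: S => S [n Rn SE]; exists n; apply/SE. Qed.
Definition PER : univ :=
  @Univ perA (fun R => @Asm {S | is_class (sval R) S} (fun n S => sval S n) (@class_rz_ex (sval R))).

(* The universe 2, with el(0) empty and el(1) a singleton. *)
Definition TWO : univ := @Univ boolA (fun b => propA (b = true)).

(* [ipt J false] and [ipt J true] are the end-points 0 and 1. *)
Record interval (C : icat) := Interval { iob : ob C; ipt : bool -> tm (yo iob) }.

Definition Int (C : icat) (J : interval C) : psh C := yo (iob J).
Definition pt (C : icat) (J : interval C) (e : bool) (c : ob C) : Int J c := sval (ipt J e) c.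
Definition Cof (C : icat) : psh C := HS C TWO.
Definition top (C : icat) (c : ob C) : ob (El (yo c)) := (c; idm c).

Section Fib.
Variables (C : icat) (J : interval C) (G : psh C) (A : psh (El G)).

Definition gpath := arr (Int J) G.

(* The value p(i)|g of p : I -> Gamma at stage c, for x = (d, g : d -> c) and i in I(d). *)
Definition pev (c : ob C) (p : gpath c) (x : ob (El (yo c))) (i : Int J (projT1 x)) : G (projT1 x) :=
  sval p (projT1 x) (projT2 x) i.

Lemma pev_res c (p : gpath c) (x y : ob (El (yo c))) (k : hom y x) i :
  res G (sval k) (pev p i) = @pev c p y (res (Int J) (sval k) i).
Proof.
case: x y k i => x g [y h] [k] /= e i; have [pn _] := svalP p.
by rewrite /pev /= -[X in sval p y X]e pn.
Qed.
Lemma pev_pt c (p : gpath c) e (x : ob (El (yo c))) :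
  res G (projT2 x) (@pev c p (top c) (pt J e c)) = @pev c p x (pt J e (projT1 x)).
Proof.
have [tn _] := svalP (ipt J e).
rewrite [in RHS]/pt (tn _ _ (projT2 x)).
by rewrite -(@pev_res c p (top c) x (exist _ (projT2 x) (cmp1m _))).
Qed.

(* Elements at stage c of the type  phi -> \Pi_i A(p i),  uncurried. *)
Definition tube_fam c (p : gpath c) (phi : Cof C c) :=
  forall (x : ob (El (yo c))) (u : uel (phi x)) (i : Int J (projT1 x)),
    A (projT1 x; pev p i).
Definition tube_nat c (p : gpath c) phi (f : tube_fam p phi) :=
  forall (x y : ob (El (yo c))) (k : hom y x) (u : uel (phi x)) (i : Int J (projT1 x)),
    f y (uact phi k u) (res (Int J) (sval k) i) = res A (elhom (sval k) (pev_res p k i)) (f x u i).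
Definition tube_rz c (p : gpath c) phi (e : nat) (f : tube_fam p phi) :=
  forall x (u : uel (phi x)) i nx nu ni, nx ||- x -> nu ||- u -> ni ||- i ->
    yields e << nx, nu, ni >> (f x u i).
Definition tubeA c (p : gpath c) (phi : Cof C c) : asm :=
  @Asm {f : tube_fam p phi | tube_nat f /\ exists e, tube_rz e f}
       (fun e f => tube_rz e (sval f)) (fun f => proj2 (svalP f)).

(* A(p e) at stage c *)
Definition face c (p : gpath c) (e : bool) : asm := A (c; @pev c p (top c) (pt J e c)).

(* forall u : phi, f u e = a *)
Definition agree c (p : gpath c) phi (f : tubeA p phi) (e : bool) (a : face p e) :=
  forall x (u : uel (phi x)), sval f x u (pt J e _) = res A (elhom (projT2 x) (pev_pt p e x)) a.

Lemma tube_res_ax c d (h : hom d c) (p : gpath c) (phi : Cof C c) (f : tubeA p phi) :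
  let g : tube_fam (res gpath h p) (res (Cof C) h phi) :=
    fun x u i => sval f (elmap (yo_map h) x) u i in
  tube_nat g /\ exists e, tube_rz e g.
Proof.
case: f => f [fn [ef Hf]] g; split.
  move=> x y k u i; rewrite /g /=.
  rewrite (fn _ _ (fhom (elmap (yo_map h)) k) u i) /=.
  by congr (res A _ _); exact: sval_inj.
have [e He] := fob_tr (elmap (yo_map h)).
exists (code (App (Cst ef) (Pair (App (Cst e) (Fst Arg)) (Snd Arg)))) => x u i nx nu ni Hx Hu Hi.
have [m [k r]] := He _ _ Hx; have [m' [k' r']] := Hf _ _ _ _ _ _ r Hu Hi.
by apply: yieldsI r'; run.
Qed.
Definition tube_res c d (h : hom d c) (p : gpath c) (phi : Cof C c) (f : tubeA p phi) :
  tubeA (res gpath h p) (res (Cof C) h phi) := exist _ _ (tube_res_ax h f).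

Lemma face_res_ax c d (h : hom d c) (p : gpath c) e :
  res G h (@pev c p (top c) (pt J e c)) = @pev d (res gpath h p) (top d) (pt J e d).
Proof. by rewrite (@pev_pt c p e (d; h)) /pev /= /pi_res_fam cmpm1. Qed.
Definition face_res c d (h : hom d c) (p : gpath c) e (a : face p e) : face (res gpath h p) e :=
  res A (elhom h (face_res_ax h p e)) a.

Lemma agree_res c d (h : hom d c) (p : gpath c) phi (f : tubeA p phi) e (a : face p e) :
  agree f a -> agree (tube_res h f) (face_res h a).
Proof.
move=> H x u; rewrite /= (H (elmap (yo_map h) x) u) /face_res -resM.
by congr (res A _ a); exact: sval_inj.
Qed.

(* The global elements of Fib(A) = \Pi_(p : I -> Gamma) Comp^i(A(p i)), with the
   iterated product uncurried: a natural, uniformly tracked choice, at every stage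
   c, of a' in A(p e') agreeing with f, for e' the other end-point. No realizer of
   the agreement hypothesis is passed since identity types have trivial ones. *)
Definition comp_fam := forall c (p : gpath c) (e : bool) (phi : Cof C c)
  (f : tubeA p phi) (a : face p e), agree f a -> face p (~~ e).
Definition comp_ext (k : comp_fam) :=
  forall c (p : gpath c) e phi (f : tubeA p phi) (a : face p e) (H : agree f a), agree f (k c p e phi f a H).
Definition comp_nat (k : comp_fam) :=
  forall c d (h : hom d c) (p : gpath c) e phi (f : tubeA p phi) (a : face p e) (H : agree f a),
    k d (res gpath h p) e (res (Cof C) h phi) (tube_res h f) (face_res h a) (agree_res (h := h) H) =
    face_res h (k c p e phi f a H).
Definition comp_rz (n : nat) (k : comp_fam) :=
  forall c (p : gpath c) e phi (f : tubeA p phi) (a : face p e) (H : agree f a) nc np nphi nf na,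
    nc ||- c -> np ||- p -> nphi ||- phi -> nf ||- f -> na ||- a ->
    yields n << nc, np, nat_of_bool e, nphi, nf, na >> (k c p e phi f a H).
Definition Fib : asm :=
  @Asm {k : comp_fam | [/\ comp_ext k, comp_nat k & exists n, comp_rz n k]}
       (fun n k => comp_rz n (sval k))
       (fun k => let: And3 _ _ H := svalP k in H).
End Fib.

Definition sub_bp := App (Fst (Fst (Fst Arg)))
  (Pair (Fst (Snd Arg)) (App (Pj1 (Snd (Fst Arg))) (Snd Arg))).
Definition sub_b := App (Snd (Fst Arg))
  (Pair (Pj0 (Snd Arg)) (Pair (Lam sub_bp) (Tl2 (Snd Arg)))).
Definition sub_code := code (Lam sub_b).

Section FibSub.
Variables (C : icat) (J : interval C) (H G : psh C) (s : nt H G) (A : psh (El G)).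
Let As := subst (elmap s) A.

Definition post_fam c (p : gpath J H c) : pi_fam (subst (proj (Int J)) G) c :=
  fun d g i => s d (sval p d g i).
Lemma post_ax c (p : gpath J H c) : pi_nat (post_fam p) /\ exists e, pi_rz e (post_fam p).
Proof.
case: p => p [pn [ep Hp]]; split=> [d d' g h i|].
  by rewrite /post_fam /= pn /= nt_nat.
have [e He] := nt_tr s.
exists (code (App (Cst e) (Pair (Fst Arg) (App (Cst ep) Arg)))) => d g i nd ng ni Hd Hg Hi.
have [m [k r]] := Hp _ _ _ _ _ _ Hd Hg Hi; have [m' [k' r']] := He _ _ _ _ Hd r.
by apply: yieldsI r'; run.
Qed.
Definition post c (p : gpath J H c) : gpath J G c := exist _ _ (post_ax p).

Lemma post_tube_ax c (p : gpath J H c) phi (f : tubeA As p phi) :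
  let g : tube_fam A (post p) phi := sval f in tube_nat g /\ exists e, tube_rz e g.
Proof.
case: f => f [fn fr] g; split=> // x y k u i.
by rewrite /g /= fn /=; congr (res A _ _); exact: sval_inj.
Qed.
Definition post_tube c (p : gpath J H c) phi (f : tubeA As p phi) : tubeA A (post p) phi :=
  exist _ _ (post_tube_ax f).
Lemma post_agree c (p : gpath J H c) phi (f : tubeA As p phi) e (a : face As p e) :
  agree f a <-> @agree C J G A c (post p) phi (post_tube f) e a.
Proof.
by split=> Ha x u; refine (etrans (Ha x u) _); congr (res A _ a); exact: sval_inj.
Qed.

Lemma comp_irr (k : comp_fam J A) c t pf pf' e phi
    (f : tubeA A (exist _ t pf : gpath J G c) phi) (f' : tubeA A (exist _ t pf' : gpath J G c) phi)
    (a : face A (exist _ t pf : gpath J G c) e) (a' : face A (exist _ t pf' : gpath J G c) e) Ha Ha' :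
  (forall x u i, sval f x u i = sval f' x u i) -> a = a' ->
  k c (exist _ t pf) e phi f a Ha = k c (exist _ t pf') e phi f' a' Ha'.
Proof.
have epf : pf = pf' by exact: Prop_irrelevance.
case: _ / epf f' a' Ha' => f' a' Ha' ff' ea; case: _ / ea Ha' => Ha'.
have ef : f = f'.
  apply: sval_inj; apply: functional_extensionality_dep => x.
  by apply: functional_extensionality_dep => u; apply: functional_extensionality_dep.
by case: _ / ef Ha' => Ha'; rewrite (Prop_irrelevance Ha Ha').
Qed.

Definition sub_fam (k : comp_fam J A) : comp_fam J As :=
  fun c p e phi f a Ha => k c (post p) e phi (post_tube f) a (proj1 (post_agree f a) Ha).

Lemma sub_fam_rz nk ns (k : comp_fam J A) : comp_rz nk k ->
  (forall x (a : H x) nx na, nx ||- x -> na ||- a -> yields ns << nx, na >> (s x a)) ->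
  exists m, kapp sub_code << ns, nk >> m /\ comp_rz m (sub_fam k).
Proof.
move=> Hk Hs; eexists; split; first by rewrite /sub_code; run.
move=> c p e phi f a Ha nc np nphi nf na Hc Hp Hphi Hf Ha'.
set env := << << ns, nk >>, nc, np, nat_of_bool e, nphi, nf, na >>.
have Hpp : clo sub_bp env ||- post p.
  move=> d g i nd ng ni Hd Hg Hi.
  have [m [h r]] := Hp _ _ _ _ _ _ Hd Hg Hi; have [m' [h' r']] := Hs _ _ _ _ Hd r.
  by apply: yieldsI r'; rewrite /env; run.
have Hff : nf ||- post_tube f by exact: Hf.
have [m [h r]] := Hk _ _ _ _ _ _ (proj1 (post_agree f a) Ha) _ _ _ _ _ Hc Hpp Hphi Hff Ha'.
by apply: yieldsI r; rewrite /env in h; run.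
Qed.
Lemma fib_sub_ax (k : Fib J A) :
  [/\ comp_ext (sub_fam (sval k)), comp_nat (sub_fam (sval k)) & exists n, comp_rz n (sub_fam (sval k))].
Proof.
case: k => k [k1 k2 [nk Hk]]; split=> /=.
- move=> c p e phi f a Ha; apply/post_agree; exact: k1.
- move=> c d h p e phi f a Ha; rewrite /sub_fam.
  have kE := k2 c d h (post p) e phi (post_tube f) a (proj1 (post_agree f a) Ha).
  transitivity (face_res h (k c (post p) e phi (post_tube f) a (proj1 (post_agree f a) Ha)));
    last by rewrite /face_res /=; congr (res A _ _); exact: sval_inj.
  rewrite -kE; apply: comp_irr => //.
  by rewrite /face_res /=; congr (res A _ _); exact: sval_inj.
- have [ns Hs] := nt_tr s.
  by have [m [_ Hm]] := sub_fam_rz Hk Hs; exists m.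
Qed.
Definition fib_sub (k : Fib J A) : Fib J As := exist _ _ (fib_sub_ax k).
End FibSub.

(* U^F(c) consists of the types in U over the representable y(c) together with a
   global element of Fib. When C has finite products, a map p : y(d) x I -> Gamma
   factors through the representable y(d x I), so that a map Gamma -> U^F is the
   same as a map Gamma -> U with a global element of Fib of the type it names. *)
Section UF.
Variables (C : icat) (J : interval C).
Definition U : psh C := HS C PER.
Definition uf_ob (c : ob C) : asm := sigA (fun F : U c => Fib J (upsh F)).
Definition uf_sub (G H : psh C) (s : nt H G) (F : ufun PER (El G)) (k : Fib J (upsh F)) :
  Fib J (upsh (uprecomp F (elmap s))) := fib_sub s k.
Definition uf_res c d (h : hom c d) (p : uf_ob d) : uf_ob c :=
  (res U h (projT1 p); uf_sub (yo_map h) (projT2 p)).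

Definition uf_cast (D : icat) (F F' : ufun PER D) (e : F = F') z (w : uel (F z)) : uel (F' z) :=
  eq_rect F (fun F : ufun PER D => uel (F z)) w F' e.
Lemma uf_cast_id (D : icat) (F F' : ufun PER D) (e : F = F') z (e' : F z = F' z) (w : uel (F z)) :
  uf_cast e w = eq_rect (F z) (fun u => uel u) w (F' z) e'.
Proof. by case: _ / e e' => e'; rewrite (Prop_irrelevance e' erefl). Qed.
Lemma uf_ext (G : psh C) (F F' : ufun PER (El G)) (e : F = F')
    (k : Fib J (upsh F)) (k' : Fib J (upsh F')) :
  (forall c p b phi f f' a a' Ha Ha',
    (forall x u i, uf_cast e (sval f x u i) = sval f' x u i) -> uf_cast e a = a' ->
    uf_cast e (sval k c p b phi f a Ha) = sval k' c p b phi f' a' Ha') ->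
  existT (fun F => Fib J (upsh F)) F k = existT (fun F => Fib J (upsh F)) F' k'.
Proof.
case: _ / e k' => k' E; congr existT; apply: sval_inj.
do 5 (apply: functional_extensionality_dep => ?).
apply: functional_extensionality_dep => a; apply: functional_extensionality_dep => Ha.
exact: E.
Qed.

Ltac uncast := match goal with |- context [@uf_cast ?D ?F ?F' ?e ?z ?w] =>
  rewrite (@uf_cast_id D F F' e z (erefl (F z)) w) /= end.

Lemma uf_res1 c (p : uf_ob c) : uf_res (idm c) p = p.
Proof.
case: p => F k; rewrite /uf_res /= /hs_res yo_map1.
apply: (uf_ext (e := uprecomp_id F)) => d [t pf] b phi f f' a a' Ha Ha' ff' aa'.
uncast; refine (@comp_irr C J (yo c) (upsh F) (sval k) d t _ pf b phi _ f' _ a' _ Ha' _ _);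
  last by rewrite -aa'; uncast.
by move=> x u i; rewrite -ff'; uncast.
Qed.
Lemma uf_resM c d e (g : hom d e) (f : hom c d) (p : uf_ob e) :
  uf_res (cmp g f) p = uf_res f (uf_res g p).
Proof.
case: p => F k; rewrite /uf_res /= /hs_res yo_mapM.
apply: (uf_ext (e := uprecomp_cmp F (yo_map g) (yo_map f))) =>
  z [t pf] b phi h h' a a' Ha Ha' hh' aa'.
uncast.
pose q := post (nt_cmp (yo_map g) (yo_map f)) (exist _ t pf : gpath J (yo c) z).
refine (@comp_irr C J (yo e) (upsh F) (sval k) z (sval q) _ _ b phi _ _ _ _ _ _ _ _);
  last by rewrite -aa'; uncast.
by move=> x u i; refine (etrans _ (hh' x u i)); uncast.
Qed.
Lemma uf_res_tr : exists e, forall c d (h : hom c d) (p : uf_ob d) nc nd nh np,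
  nc ||- c -> nd ||- d -> nh ||- h -> np ||- p ->
  yields e << nc, nd, nh, np >> (uf_res h p).
Proof.
have [eu Hu] := res_tr U; have [ec Hcm] := cmp_tr C.
pose b := App (Cst ec) (Pair (Fst (Snd Arg)) (Pair (Pj0 (Fst Arg)) (Pair (Pj1 (Fst Arg))
  (Pair (Pj2 (Fst Arg)) (Snd (Snd Arg)))))).
exists (code (Pair (App (Cst eu) (Pair (Pj0 Arg) (Pair (Pj1 Arg) (Pair (Pj2 Arg) (Fst (Tl3 Arg))))))
  (App (Cst sub_code) (Pair (Lam b) (Snd (Tl3 Arg)))))).
move=> c d h [F k] nc nd nh np Hc Hd Hh [nF [nk [-> HF Hk]]].
have [m [ke r]] := Hu _ _ _ _ _ _ _ _ Hc Hd Hh HF.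
set env := << nc, nd, nh, nF, nk >>.
have [|m' [ke' r']] := @sub_fam_rz C J (yo c) (yo d) (yo_map h) (upsh F) nk (clo b env) (sval k) Hk.
  move=> x a nx na Hx Ha.
  have [m' [ke' r']] := Hcm _ _ _ _ _ _ _ _ _ _ Hx Hc Hd Hh Ha.
  by apply: yieldsI r'; rewrite /env; run.
exists << m, m' >>; split; last by exists m, m'.
by rewrite /env in ke' *; run.
Qed.
Definition UF : psh C := Psh uf_res1 uf_resM uf_res_tr.

Lemma uf_fst_tr : exists e, forall x (p : UF x) nx np,
  nx ||- x -> np ||- p -> yields e << nx, np >> (projT1 p).
Proof.
by exists (code (Fst (Snd Arg))) => x p nx np _ [a [b [-> Ha _]]]; apply: yieldsI Ha; run.
Qed.
Definition uf_fst : nt UF U :=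
  @NT C UF U (fun _ p => projT1 p) (fun _ _ _ _ => erefl) uf_fst_tr.
Definition uf_el : psh (El UF) := subst (elmap uf_fst) (hs_el C PER).
End UF.

(* Types in a context D over C, i.e. presheaves on a category D with a functor P : D -> C. *)
Section Types.
Variables (C : icat) (J : interval C).

Section Path.
Variables (D : icat) (P : ifun D C) (A : psh D) (a0 a1 : tm A).
Definition intD : psh D := subst P (Int J).
Definition is_path x (p : arr intD A x) :=
  sval p x (idm x) (pt J false (P x)) = sval a0 x /\
  sval p x (idm x) (pt J true (P x)) = sval a1 x.
Lemma is_path_end x y (f : hom x y) (p : arr intD A y) e :
  sval (res (arr intD A) f p) x (idm x) (pt J e (P x)) =
  res A f (sval p y (idm y) (pt J e (P y))).
Proof.
have [pn _] := svalP p; have [tn _] := svalP (ipt J e).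
have := pn _ _ (idm y) f (pt J e (P y)); rewrite /= => <-.
by rewrite /pi_res_fam cmpm1 cmp1m /pt (tn _ _ (fhom P f)).
Qed.
Lemma is_path_res x y (f : hom x y) p : is_path p -> is_path (res (arr intD A) f p).
Proof.
move=> [p0 p1]; rewrite /is_path !is_path_end p0 p1.
by have [<- _] := svalP a0; have [<- _] := svalP a1.
Qed.
Definition Path : psh D := Sub is_path_res.
End Path.

Section Contr.
Variables (D : icat) (P : ifun D C) (X : psh D).
Let X1 := subst (proj X) X.
(* x0 : X |- \Pi_(x1 : X) Path(X, x0, x1) *)
Definition all_paths : psh (El X) :=
  Pi (Path (fcomp P (fcomp (proj X) (proj X1))) (tmsub (proj X1) (var X)) (var X1)).
Definition is_prop : psh D := Pi all_paths.
Definition is_contr : psh D := Sig all_paths.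
End Contr.

Section Equiv.
Variables (D : icat) (P : ifun D C) (A B : psh D) (f : tm (arr A B)).
Let A1 := subst (proj B) A.
Let F := fcomp (proj B) (proj A1).
(* b : B |- \Sigma_(a : A) Path(B, b, f a) *)
Definition fiber : psh (El B) :=
  Sig (@Path _ (fcomp P F) (subst F B) (tmsub (proj A1) (var B)) (papp (tmsub F f) (var A1))).
Definition is_equiv : psh D := Pi (is_contr (fcomp P (proj B)) fiber).
End Equiv.

Definition hProp : psh C := Sig (is_prop (proj (UF J)) (uf_el J)).

Section Star.
Variables (D : icat) (P : ifun D C) (A : psh D).
Definition hPropD : psh D := subst P hProp.
Definition hel : psh (El hPropD) := subst (fcomp (elmap (sg_fst _)) (lift P hProp)) (uf_el J).
Definition Apb : psh (El hPropD) := subst (proj hPropD) A.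
(* \Pi_(X : hProp) (A -> X) -> X *)
Definition star : psh D := Pi (arr (arr Apb hel) hel).

(* \lambda f. f a *)
Definition eta3_fam y (a : A y) z (g : hom z y) (X : hPropD z) :
    pi_fam (subst (proj (arr Apb hel)) hel) ((z; X) : ob (El hPropD)) :=
  fun w k h => sval h w (idm w) (res A (cmp g (sval k)) a).
Arguments eta3_fam {y} a {z} g X.
Lemma eta3_nat y (a : A y) z (g : hom z y) (X : hPropD z) : pi_nat (eta3_fam a g X).
Proof.
move=> w w' k l h; rewrite /eta3_fam /=.
have [hn _] := svalP h.
have := hn _ _ (idm w) l (res A (cmp g (sval k)) a); rewrite /= => <-.
by rewrite /pi_res_fam (cmpm1 (i := El _)) el_cmp1m cmpA resM.
Qed.
Definition eta3_code (ei er ec : nat) (o t : expr) : expr :=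
  (* o = << << ny, na >>, nz, ng, nX >>, t = << nw, nk, nh >> *)
  App (Tl2 t) (Pair (Fst t) (Pair (App (Cst ei) (Fst t))
    (App (Cst er) (Pair (Fst (Fst t)) (Pair (Fst (Fst o))
      (Pair (App (Cst ec) (Pair (Fst (Fst t)) (Pair (Pj1 o) (Pair (Fst (Fst o))
        (Pair (Pj2 o) (Pj1 t)))))) (Snd (Fst o)))))))).
Lemma eta3_rz : exists b, forall y (a : A y) z (g : hom z y) (X : hPropD z) ny na nz ng nX,
  ny ||- y -> na ||- a -> nz ||- z -> ng ||- g ->
  pi_rz (clo b << << ny, na >>, nz, ng, nX >>) (eta3_fam a g X).
Proof.
have [ei Hi] := idm_tr (El hPropD); have [er Hr] := res_tr A; have [ec Hc] := cmp_tr D.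
exists (eta3_code ei er ec (Fst Arg) (Snd Arg)).
move=> y a z g X ny na nz ng nX Hy Ha Hz Hg w k h nw nk nh Hw Hk Hh.
have [m1 [k1 r1]] := Hi _ _ Hw; case: (Hw) => nw1 [nw2 [ew Hw1 Hw2]].
have [m2 [k2 r2]] := Hc _ _ _ _ _ _ _ _ _ _ Hw1 Hz Hy Hg Hk.
have [m3 [k3 r3]] := Hr _ _ _ _ _ _ _ _ Hw1 Hy r2 Ha.
have [m4 [k4 r4]] := Hh _ _ _ _ _ _ Hw r1 r3.
by apply: yieldsI r4; rewrite ew in k1 k4 *; run.
Qed.
Lemma eta3_ax y (a : A y) z (g : hom z y) (X : hPropD z) :
  pi_nat (eta3_fam a g X) /\ exists e, pi_rz e (eta3_fam a g X).
Proof.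
split; first exact: eta3_nat.
have [ny Hy] := rz_ex y; have [na Ha] := rz_ex a; have [nz Hz] := rz_ex z.
have [ng Hg] := rz_ex g; have [b Hb] := eta3_rz; eexists; exact: (Hb y a z g X ny na nz ng 0).
Qed.
(* \lambda X f. f a *)
Definition eta2_fam y (a : A y) : pi_fam (arr (arr Apb hel) hel) y :=
  fun z g X => exist _ _ (eta3_ax a g X).
Lemma eta2_ax y (a : A y) : pi_nat (eta2_fam a) /\ exists e, pi_rz e (eta2_fam a).
Proof.
split=> [z z' g l X|].
  by apply: pi_ext => w k h; rewrite /= /pi_res_fam /eta3_fam /= cmpA.
have [ny Hy] := rz_ex y; have [na Ha] := rz_ex a; have [b Hb] := eta3_rz.
exists (clo (Lam b) << ny, na >>) => z g X nz ng nX Hz Hg HX.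
eexists; split; first by run.
by apply: Hb.
Qed.
Definition eta2 y (a : A y) : star y := exist _ _ (eta2_ax a).
Definition eta1_fam x : pi_fam (subst (proj A) star) x := fun y _ a => eta2 a.
Lemma eta1_rz : exists e, forall x, pi_rz e (@eta1_fam x).
Proof.
have [b Hb] := eta3_rz.
exists (code (App (Cst (code (Lam (Lam b)))) (Pair (Fst Arg) (Tl2 Arg)))).
move=> x y f a ny nf na Hy Hf Ha; eexists; split; first by run.
move=> z g X nz ng nX Hz Hg HX; eexists; split; first by run.
exact: Hb.
Qed.
Lemma eta1_ax x : pi_nat (@eta1_fam x) /\ exists e, pi_rz e (@eta1_fam x).
Proof.
split; last by have [e He] := eta1_rz; exists e; exact: He.
move=> y z f g a; apply: pi_ext => z' h X; apply: pi_ext => w k l.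
by rewrite /= /pi_res_fam /= /eta3_fam -resM cmpA.
Qed.
Definition eta1 x : arr A star x := exist _ _ (eta1_ax x).
Lemma eta_ax : @tm_ax D (arr A star) eta1.
Proof.
split=> [x y f|]; first exact: pi_ext.
by have [e He] := eta1_rz; exists (c_cst e) => x n _; exists e; split; [constructor | exact: He].
Qed.
Definition eta : tm (arr A star) := exist _ _ eta_ax.
End Star.
End Types.

Definition uniform (D : icat) (A : psh D) := forall x, exists n, forall a : A x, n ||- a.

Definition is_coeq (D : icat) (R A B : psh D) (r0 r1 : nt R A) (q : nt A B) :=
  nt_cmp q r0 = nt_cmp q r1 /\
  forall (Q : psh D) (t : nt A Q), nt_cmp t r0 = nt_cmp t r1 ->
    exists! u : nt B Q, nt_cmp u q = t.
Definition regular_epi (D : icat) (A B : psh D) (q : nt A B) :=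
  exists (R : psh D) (r0 r1 : nt R A), is_coeq r0 r1 q.
Definition well_supported (D : icat) (A : psh D) := regular_epi (to_one A).

Definition cube (m : nat) : asm := expA (ordA m) boolA.
Definition cube_le m (v w : cube m) := forall k, sval v k -> sval w k.
Definition monotone m n (f : expA (cube m) (cube n)) :=
  forall v w, cube_le v w -> cube_le (sval f v) (sval f w).
Definition bord_hom (m n : natA) : asm := subA (@monotone m n).

Lemma bord_id_ax m : exists e, @tracks (cube m) (cube m) e id.
Proof. by exists c_id => v n Hv; exists n; split=> //; constructor. Qed.
Definition bord_id (m : natA) : bord_hom m m :=
  exist (@monotone m m) (exist _ id (bord_id_ax m)) (fun _ _ vw => vw).
Lemma bord_cmp_rz l m n (g : expA (cube m) (cube n)) (f : expA (cube l) (cube m)) ng nf :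
  ng ||- g -> nf ||- f -> @tracks (cube l) (cube n)
    (clo (App (Fst (Fst Arg)) (App (Snd (Fst Arg)) (Snd Arg))) << ng, nf >>)
    (sval g \o sval f).
Proof.
move=> Hg Hf v k Hv; have [m1 [k1 r1]] := Hf _ _ Hv; have [m2 [k2 r2]] := Hg _ _ r1.
by apply: yieldsI r2; run.
Qed.
Lemma bord_cmp_ax l m n (g : expA (cube m) (cube n)) (f : expA (cube l) (cube m)) :
  exists e, @tracks (cube l) (cube n) e (sval g \o sval f).
Proof.
have [ng Hg] := rz_ex g; have [nf Hf] := rz_ex f; eexists; exact: bord_cmp_rz Hg Hf.
Qed.
Lemma bord_cmp_mon (l m n : natA) (g : bord_hom m n) (f : bord_hom l m) :
  @monotone l n (exist _ _ (bord_cmp_ax (sval g) (sval f))).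
Proof. by move=> v w vw; apply: (svalP g); exact: (svalP f). Qed.
Definition bord_cmp (l m n : natA) (g : bord_hom m n) (f : bord_hom l m) : bord_hom l n :=
  exist _ _ (@bord_cmp_mon l m n g f).
Lemma bord_ext (m n : natA) (f g : bord_hom m n) : sval (sval f) =1 sval (sval g) -> f = g.
Proof. by move=> fg; apply: sval_inj; apply: sval_inj; exact: funext. Qed.
Lemma bord_id_tr : exists e, forall (m : natA) n, n ||- m -> yields e n (bord_id m).
Proof.
exists (c_cst c_id) => m n _; exists c_id; split; first by constructor.
by move=> v k Hv; exists k; split=> //; constructor.
Qed.
Lemma bord_cmp_tr : exists e, forall (x y z : natA) (g : bord_hom y z) (f : bord_hom x y) nx ny nz ng nf,
    nx ||- x -> ny ||- y -> nz ||- z -> ng ||- g -> nf ||- f ->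
    yields e << nx, ny, nz, ng, nf >> (bord_cmp g f).
Proof.
exists (code (App (Cst (code (Lam (App (Fst (Fst Arg)) (App (Snd (Fst Arg)) (Snd Arg))))))
  (Tl3 Arg))) => x y z g f nx ny nz ng nf _ _ _ Hg Hf.
eexists; split; first by run.
exact: bord_cmp_rz.
Qed.
Lemma bord_1m m n (f : bord_hom m n) : bord_cmp (bord_id n) f = f.
Proof. exact: bord_ext. Qed.
Lemma bord_m1 m n (f : bord_hom m n) : bord_cmp f (bord_id m) = f.
Proof. exact: bord_ext. Qed.
Lemma bord_A k l m n (h : bord_hom m n) (g : bord_hom l m) (f : bord_hom k l) :
  bord_cmp h (bord_cmp g f) = bord_cmp (bord_cmp h g) f.
Proof. exact: bord_ext. Qed.
Definition Bord : icat := ICat bord_1m bord_m1 bord_A bord_id_tr bord_cmp_tr.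

Lemma cube_cst_ax m (b : bool) : exists e, @tracks (ordA m) boolA e (fun=> b).
Proof. by exists (c_cst (nat_of_bool b)) => i n _; exists (nat_of_bool b); split=> //; constructor. Qed.
Definition cube_cst m (b : bool) : cube m := exist _ _ (cube_cst_ax m b).
Lemma bord_cst_rz m n b : @tracks (cube m) (cube n) (c_cst (c_cst (nat_of_bool b))) (fun=> cube_cst n b).
Proof.
move=> v k _; eexists; split; first by constructor.
by move=> i j _; exists (nat_of_bool b); split=> //; constructor.
Qed.
Lemma bord_cst_ax m n b : exists e, @tracks (cube m) (cube n) e (fun=> cube_cst n b).
Proof. by eexists; exact: bord_cst_rz. Qed.
Definition bord_cst (m n : natA) (b : bool) : bord_hom m n :=
  exist (@monotone m n) (exist _ _ (bord_cst_ax m n b)) (fun _ _ _ _ H => H).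
Lemma bord_pt_ax b : @tm_ax Bord (yo (1 : ob Bord)) (fun m => bord_cst m 1 b).
Proof.
split=> [x y f|]; first exact: bord_ext.
exists (c_cst (c_cst (c_cst (nat_of_bool b)))) => x n _.
by eexists; split; [by constructor | exact: bord_cst_rz].
Qed.
Definition BordI : interval Bord := @Interval Bord 1 (fun b => exist _ _ (bord_pt_ax b)).

(* Main.v *)
Require Import Defs.
From mathcomp Require Import all_boot.
From mathcomp Require Import boolp.

Set Implicit Arguments.
Unset Strict Implicit.
Unset Printing Implicit Defensive.

(** An inverse of [eta] turns global sections of [A^*] into global sections of
    [A], so it suffices to produce a section of [A^*]. Given X in hProp and
    f : A -> X, well-supportedness computes a realizer of some element a of A,
    hence one of f a. As A is uniform and X is modest, f is constant, so f a
    depends neither on a nor on the stage, and the choice is natural. *)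

(* [step] is a function that fixes the states with empty stack. *)
Lemma kapp_det e n m m' : kapp e n m -> kapp e n m' -> m = m'.
Proof.
have halt k v : iter k step << 0, v >> = << 0, v >>.
  by elim: k => //= k ->; rewrite /step un1_pr.
have le_eq j k s v v' : j <= k -> iter j step s = << 0, v >> -> iter k step s = << 0, v' >> -> v = v'.
  move=> jk ej; rewrite -(subnK jk) iterD ej halt => /pr_inj[_ ->] //.
move=> /kapp_reach/(_ 0) [j ej] /kapp_reach/(_ 0) [k ek].
case: (leqP j k) => [|/ltnW] jk; first exact: le_eq jk ej ek.
by apply/esym; exact: le_eq jk ek ej.
Qed.

Lemma per_modest (R : PER) (S T : uel R) n : n ||- S -> n ||- T -> S = T.
Proof.
case: R S T => R [Rs Rt] [S [k Rk Sk]] [T [l Rl Tl]] /= /Sk kn /Tl ln.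
apply: sval_inj; apply: funext => m /=; apply: propext.
have kl : R k l by apply: Rt kn (Rs _ _ ln).
by split=> [/Sk km|/Tl lm]; [apply/Tl; apply: Rt (Rs _ _ kl) km | apply/Sk; apply: Rt kl lm].
Qed.

Section Support.
Variables (D : icat) (A : psh D).

Definition has_rz (x : ob D) : Prop := exists n (a : A x), n ||- a.
(** By proof irrelevance there is at most one element, yet its realizers still compute realizers of
    elements of [A x]: a truncation of [A x]. *)
Definition supp_at (x : ob D) : asm :=
  @Asm (has_rz x) (fun n _ => exists a : A x, n ||- a) id.

Lemma supp_res x y (f : hom x y) : has_rz y -> has_rz x.
Proof. by case=> n [a _]; have [m Hm] := rz_ex (res A f a); exists m, (res A f a). Qed.

Lemma supp_res_tr : exists e, forall x y (f : hom x y) (p : supp_at y) nx ny nf np,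
  nx ||- x -> ny ||- y -> nf ||- f -> np ||- p ->
  yields e << nx, ny, nf, np >> (supp_res f p : supp_at x).
Proof.
have [e He] := res_tr A; exists e => x y f p nx ny nf np Hx Hy Hf [a Ha].
have [m [k r]] := He _ _ _ _ _ _ _ _ Hx Hy Hf Ha.
by exists m; split=> //; exists (res A f a).
Qed.

(* The regular image of A -> 1. *)
Definition supp : psh D :=
  @Psh D supp_at supp_res (fun _ _ => @Prop_irrelevance (has_rz _) _ _)
    (fun _ _ _ _ _ _ => @Prop_irrelevance (has_rz _) _ _) supp_res_tr.

Lemma to_supp_at x : A x -> has_rz x.
Proof. by move=> a; have [m Hm] := rz_ex a; exists m, a. Qed.

Lemma to_supp_tr : exists e, forall x (a : A x) nx na,
  nx ||- x -> na ||- a -> yields e << nx, na >> (to_supp_at a : supp x).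
Proof.
exists (code (Snd Arg)) => x a nx na _ Ha; exists na; split; first by run.
by exists a.
Qed.
Definition to_supp : nt A supp :=
  @NT D A supp to_supp_at (fun _ _ _ _ => @Prop_irrelevance (has_rz _) _ _) to_supp_tr.

(** [supp] has at most one element at each stage, so [to_supp] coequalizes [r0] and [r1] and factors
    through [one]. A tracker of the factor computes the realizers. *)
Lemma well_supported_tracked : well_supported A ->
  exists e, forall x n, n ||- x -> exists a : A x, yields e n a.
Proof.
move=> [R [r0 [r1 [_ U]]]].
have [|u _] := U supp to_supp; first by apply: nt_eq => x a; exact: (@Prop_irrelevance (has_rz _)).
have [e He] := nt_tr u.
exists (code (App (Cst e) (Pair Arg (Cst 0)))) => x n Hx.
have [m [k [a Ha]]] := He x I n 0 Hx I.
by exists a; apply: yieldsI Ha; run.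
Qed.
End Support.

Section StarSection.
Variables (C : icat) (J : interval C) (D : icat) (P : ifun D C) (A : psh D).
Hypotheses (unifA : uniform A) (wsA : well_supported A).
Let H := hPropD J P.
Let X : psh (El H) := hel J P.

(** A tracker of [h] sends a realizer shared by [a] and [a'] to a single number, which realizes both
    values; these lie in a modest assembly. *)
Lemma uniform_modest_const (w : ob (El H)) (h : arr (Apb J P A) X w) v (g : hom v w)
    (a a' : Apb J P A v) : sval h v g a = sval h v g a'.
Proof.
have [n Hn] := unifA (projT1 v); have [_ [e He]] := svalP h.
have [nv Hv] := rz_ex v; have [ng Hg] := rz_ex g.
have [m [k r]] := He _ _ a _ _ _ Hv Hg (Hn a).
have [m' [k' r']] := He _ _ a' _ _ _ Hv Hg (Hn a').
by rewrite -(kapp_det k k') in r'; exact: per_modest r r'.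
Qed.

Lemma some_elt_ex x : exists a : A x, True.
Proof.
have [e He] := well_supported_tracked wsA; have [n Hn] := rz_ex x.
by have [a _] := He _ _ Hn; exists a.
Qed.
(** A classical choice, neither natural nor computed; it only occurs as an argument of maps that are
    constant by [uniform_modest_const]. *)
Definition some_elt x : A x := sval (cid (some_elt_ex x)).

Definition sec3_fam (z : ob (El H)) : pi_fam (subst (proj (arr (Apb J P A) X)) X) z :=
  fun w _ h => sval h w (idm w) (some_elt (projT1 w)).
Lemma sec3_nat z : pi_nat (@sec3_fam z).
Proof.
move=> w w' k l h; rewrite /sec3_fam /=.
have [hn _] := svalP h.
have := hn _ _ (idm w) l (some_elt (projT1 w)); rewrite /= => <-.
rewrite /pi_res_fam (cmpm1 (i := El _)) el_cmp1m.
(* What remains is to compare the restriction of the element chosen at [w] with the one chosen at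
   [w']; [h] does not distinguish them. *)
exact: uniform_modest_const.
Qed.
Lemma sec3_rz : exists e, forall z, pi_rz e (@sec3_fam z).
Proof.
have [ei Hi] := idm_tr (El H); have [e He] := well_supported_tracked wsA.
exists (code (App (Tl2 Arg) (Pair (Fst Arg) (Pair (App (Cst ei) (Fst Arg))
  (App (Cst e) (Fst (Fst Arg))))))).
move=> z w k h nw nk nh Hw Hk Hh.
have [m1 [k1 r1]] := Hi _ _ Hw; case: (Hw) => nw1 [nw2 [ew Hw1 Hw2]].
have [a [m2 [k2 r2]]] := He _ _ Hw1.
have [m3 [k3 r3]] := Hh _ _ _ _ _ _ Hw r1 (r2 : m2 ||- (a : Apb J P A w)).
(* The computed realizer belongs to some [a] that may differ from the chosen element, but [h] has
   the same value at both. *)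
have -> : sec3_fam k h = sval h w (idm w) a by exact: uniform_modest_const.
by apply: yieldsI r3; rewrite ew in k1 k3 *; run.
Qed.
Definition sec3 z : arr (arr (Apb J P A) X) X z :=
  exist _ _ (conj (@sec3_nat z) (let: ex_intro e He := sec3_rz in ex_intro _ e (He z))).

Definition sec2_fam x : pi_fam (arr (arr (Apb J P A) X) X) x := fun y _ Y => sec3 (y; Y).
Lemma sec2_rz : exists e, forall x, pi_rz e (@sec2_fam x).
Proof.
have [e He] := sec3_rz; exists (c_cst e) => x y f Y ny nf nY _ _ _.
by exists e; split; [constructor | exact: He].
Qed.
Lemma sec2_ax x : pi_nat (@sec2_fam x) /\ exists e, pi_rz e (@sec2_fam x).
Proof.
split; last by have [e He] := sec2_rz; exists e; exact: He.
by move=> y z f g Y; exact: pi_ext.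
Qed.
Lemma star_section_ax : @tm_ax D (star J P A) (fun x => exist _ _ (sec2_ax x)).
Proof.
split=> [x y f|]; first exact: pi_ext.
by have [e He] := sec2_rz; exists (c_cst e) => x n _; exists e; split; [constructor | exact: He].
Qed.
Definition star_section : tm (star J P A) := exist _ _ star_section_ax.
End StarSection.

(** Combines naturality of [e] in the stage with naturality of its value at [y]; it makes [preimage]
    natural. *)
Lemma pi_app_res (D : icat) (B : psh D) (K : psh (El B)) (e : tm (Pi K)) x y (h : hom x y) (b : B y) :
  sval (sval e x) x (idm x) (res B h b) = res K (elhom h erefl) (sval (sval e y) y (idm y) b).
Proof.
have [en _] := svalP e; have [pn _] := svalP (sval e y).
by rewrite (en _ _ h) -pn /= /pi_res_fam cmpm1 cmp1m.
Qed.

Section EquivSection.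
Variables (C : icat) (J : interval C) (D : icat) (P : ifun D C) (A B : psh D).
Variables (f : tm (arr A B)) (e : tm (is_equiv J P f)) (s : tm B).

(** The point of [A] in the centre of contraction of the fiber over [b]. *)
Definition preimage x (b : B x) : A x := projT1 (projT1 (sval (sval e x) x (idm x) b)).
Lemma preimage_res x y (h : hom x y) (b : B y) : preimage (res B h b) = res A h (preimage b).
Proof.
exact: (congr1 (fun p => projT1 (projT1 p)) (pi_app_res e h b)).
Qed.
Lemma equiv_section_ax : @tm_ax D A (fun x => preimage (sval s x)).
Proof.
have [sn [es Hs]] := svalP s; have [_ [ee He]] := svalP e.
split=> [x y h|]; first by rewrite -preimage_res -sn.
have [ei Hi] := idm_tr D.
exists (code (Fst (Fst (App (App (Cst ee) Arg) (Pair Arg (Pair (App (Cst ei) Arg)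
  (App (Cst es) Arg))))))) => x n Hx.
have [m1 [k1 r1]] := He _ _ Hx; have [m2 [k2 r2]] := Hi _ _ Hx.
have [m3 [k3 r3]] := Hs _ _ Hx.
(* [m4] codes the centre and its contraction, and the centre codes a point and a path; [d] realizes
   the point. *)
have [m4 [k4 [c [c' [E [d [d' [E' Hd _]]] _]]]]] := r1 _ _ _ _ _ _ Hx r2 r3.
by rewrite E E' in k4; apply: yieldsI Hd; run.
Qed.
Definition equiv_section : tm A := exist _ _ equiv_section_ax.
End EquivSection.

Theorem theorem5p4 (G : psh Bord) (A : psh (El G)) (alpha : Fib BordI A) :
  uniform A -> well_supported A -> ~ inhabited (tm A) ->
  ~ inhabited (tm (is_equiv BordI (proj G) (eta BordI (proj G) A))).
Proof.
move=> unifA wsA nsec [e]; apply: nsec; constructor.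
exact: equiv_section e (star_section BordI (proj G) unifA wsA).
Qed.
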